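(* Let $n \ge 1$ and let $\varphi$ be a smooth solution on $\mathbb{R}^{n+1}$ of the free wave equation $\Box \varphi = 0$. If $(\varphi, \partial_t \varphi)$ vanishes on $B_{1}(2)$ and on $B_{-1}(2)$ (that is, both $\varphi$ and $\partial_t\varphi$ are zero at every point of these two sets), then $(\varphi,\partial_t\varphi)$ vanishes on $B_0(3)$.
   Context: Points of $\mathbb{R}^{n+1}$ are written $(t,x)$ with $t\in\mathbb{R}$ and $x=(x_1,\dots,x_n)\in\mathbb{R}^n$. $\mathbb{R}^{n+1}$ carries the standard Minkowski metric, and $\Box = -\partial_t^2 + \sum_{i=1}^n \partial_{x_i}^2$ is the associated wave operator. For $t_0\in\mathbb{R}$ and $\rho>0$, $B_{t_0}(\rho) = \{(t_0,x) : |x| < \rho\}$ denotes the $n$-dimensional ball of radius $\rho$ centered at the origin of the hyperplane $\{t=t_0\}$. *)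

(* Defs.v *)
From HB Require Import structures.
From mathcomp Require Import all_boot all_order all_algebra.
From mathcomp Require Import all_classical all_reals all_analysis.

Set Implicit Arguments.
Unset Strict Implicit.
Unset Printing Implicit Defensive.

Import Order.TTheory GRing.Theory Num.Theory.
Import numFieldNormedType.Exports.

Local Open Scope classical_set_scope.
Local Open Scope ring_scope.

(* Points (t, x) of R^(n+1), with t a real and x a vector of R^n. *)
Definition spacetime (R : realType) (n : nat) : normedModType R :=
  (R * 'rV[R]_n)%type.

Definition e_t (R : realType) (n : nat) : spacetime R n := (1, 0).

Definition e_x (R : realType) (n : nat) (i : 'I_n) : spacetime R n :=
  (0, delta_mx 0 i).

Definition dt (R : realType) (n : nat) (phi : spacetime R n -> R) :
    spacetime R n -> R :=
  'D_(e_t R n) phi.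

Definition dx (R : realType) (n : nat) (i : 'I_n) (phi : spacetime R n -> R) :
    spacetime R n -> R :=
  'D_(e_x R i) phi.

(* 'D_v f is a total function, with no meaning where f is not derivable along
   v; hence the explicit differentiability. As V is finite-dimensional in its
   uses below, asking that every 'D_v f be C^k amounts to the differential of f
   being C^k. *)
Fixpoint is_Ck (R : realType) (V : normedModType R) (k : nat) (f : V -> R) :
    Prop :=
  match k with
  | 0%N => continuous f
  | k'.+1 => (forall p, differentiable f p) /\
             (forall v : V, is_Ck k' ('D_v f))
  end.

Definition smooth (R : realType) (V : normedModType R) (f : V -> R) : Prop :=
  forall k : nat, is_Ck k f.

Definition box (R : realType) (n : nat) (phi : spacetime R n -> R)
    (p : spacetime R n) : R :=
  - dt (dt phi) p + \sum_(i < n) dx i (dx i phi) p.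

(* The norm `|x| of the library on 'rV_n is the sup norm, not this one. *)
Definition eucl_norm (R : realType) (n : nat) (x : 'rV[R]_n) : R :=
  Num.sqrt (\sum_(i < n) x 0 i ^+ 2).

Definition B (R : realType) (n : nat) (t0 rho : R) : set (spacetime R n) :=
  [set p | p.1 = t0 /\ eucl_norm p.2 < rho].

Definition data_vanish_on (R : realType) (n : nat) (phi : spacetime R n -> R)
    (A : set (spacetime R n)) : Prop :=
  forall p, A p -> phi p = 0 /\ dt phi p = 0.

(* Main.v *)
Require Import Defs.
From mathcomp Require Import all_boot all_order all_algebra.
From mathcomp Require Import all_classical all_reals all_analysis.
From mathcomp Require Import ring lra.

Set Implicit Arguments.
Unset Strict Implicit.
Unset Printing Implicit Defensive.

Import Order.TTheory GRing.Theory Num.Theory.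
Import numFieldNormedType.Exports.

Local Open Scope classical_set_scope.
Local Open Scope ring_scope.

(** An energy estimate shows that u and its gradient vanish in the backward and
forward cones over the two balls, hence wherever |x| < b and |t| + b < 3 for some
b <= 1. For fixed y with |y| small, the means of u(t, .) over the balls of centre
y and radius r, weighted by a power of 1 - |z|^2, solve a 1+1 dimensional
Euler-Poisson-Darboux equation; they vanish for small r, hence, by a Gronwall
argument along characteristics in the (t, r) plane, for |y| + |t| + r < 3.
Differentiating in y and integrating by parts, all polynomial moments of u(t, .)
on these balls vanish, and Landau-type polynomial peaks give u(t, .) = 0 there.
The only integral used is a mean over the cube [-1, 1]^n: it needs to be
linear, monotone and definite, and to satisfy integration by parts. *)

(** The cones over the two balls meet t = 0 only in |x| < 1. Going further means crossing the
    timelike boundary of a tube around the time axis, and evolving the full equation in a space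
    direction is ill-posed. Averaging over balls leaves one space variable r, and in 1+1 dimensions
    r may play the role of time; the evolution starts at r = eps > 0, away from the singular
    coefficient at r = 0. The tube ends at |t| = 3 because 3 = 1 + 2 is the height of the outer tips
    of the cones, which also fixes the radius reached at t = 0. The weight (1 - |z|^2)^(b+2),
    extended by zero, stands in for surface measures and polar coordinates: up to a constant factor,
    these ball means are spherical means in dimension N = n + 2b + 6 of functions independent of the
    additional variables, whence the coefficient N - 1 in [darboux_coef]. It also removes all
    boundary terms on the cube. *)

(** * Continuity of composite expressions *)

Section Continuity.
Variables (R : realType) (T : topologicalType).
Implicit Types f g : T -> R.

Lemma ctsD f g : continuous f -> continuous g -> continuous (fun z => f z + g z).
Proof. by move=> cf cg z; apply: cvgD; [exact: cf|exact: cg]. Qed.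

Lemma ctsN f : continuous f -> continuous (fun z => - f z).
Proof. by move=> cf z; apply: cvgN; exact: cf. Qed.

Lemma ctsM f g : continuous f -> continuous g -> continuous (fun z => f z * g z).
Proof. by move=> cf cg z; apply: cvgM; [exact: cf|exact: cg]. Qed.

Lemma ctsX f k : continuous f -> continuous (fun z => f z ^+ k).
Proof.
move=> cf; elim: k => [|k IH]; first by move=> z; apply: cvg_cst.
have -> : (fun z => f z ^+ k.+1) = (fun z => f z * f z ^+ k).
  by apply/funext => z; rewrite exprS.
exact: ctsM.
Qed.

Lemma cts_sum_seq (I : Type) (r : seq I) (F : I -> T -> R) :
  (forall i, continuous (F i)) -> continuous (fun z => \sum_(i <- r) F i z).
Proof.
move=> cF; elim: r => [|i r IH].
  by under eq_fun do rewrite big_nil; apply: cst_continuous.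
by under eq_fun do rewrite big_cons; apply: ctsD.
Qed.

Lemma cts_sum (I : finType) (F : I -> T -> R) :
  (forall i, continuous (F i)) -> continuous (fun z => \sum_i F i z).
Proof. exact: cts_sum_seq. Qed.

Lemma cts_max f g : continuous f -> continuous g ->
  continuous (fun z => Num.max (f z) (g z)).
Proof. by move=> cf cg z; apply: continuous_max; [exact: cf|exact: cg]. Qed.

Lemma cts_comp (U V : topologicalType) (h : U -> V) (c : T -> U) :
  continuous h -> continuous c -> continuous (fun z => h (c z)).
Proof. by move=> ch cc z; apply: (continuous_comp (cc z) (ch _)). Qed.

Lemma cts_pair (U V : topologicalType) (a : T -> U) (b : T -> V) :
  continuous a -> continuous b -> continuous (fun z => (a z, b z)).
Proof. by move=> ca cb z; apply: cvg_pair; [exact: ca|exact: cb]. Qed.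

Lemma cts_cst (U : topologicalType) (c : U) : continuous (fun _ : T => c).
Proof. by move=> z; apply: cvg_cst. Qed.

Variable V : normedModType R.
Lemma ctsVD (f g : T -> V) :
  continuous f -> continuous g -> continuous (fun z => f z + g z).
Proof. by move=> cf cg z; apply: cvgD; [exact: cf|exact: cg]. Qed.

Lemma ctsVZ (f : T -> R) (g : T -> V) :
  continuous f -> continuous g -> continuous (fun z => f z *: g z).
Proof. by move=> cf cg z; apply: cvgZ; [exact: cf|exact: cg]. Qed.

End Continuity.

Lemma cts_id (T : topologicalType) : continuous (fun z : T => z).
Proof. by move=> z; apply: cvg_id. Qed.

Lemma cts_fst (U V : topologicalType) : continuous (fun z : U * V => z.1).
Proof. by move=> z; exact: cvg_fst. Qed.

Lemma cts_snd (U V : topologicalType) : continuous (fun z : U * V => z.2).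
Proof. by move=> z; exact: cvg_snd. Qed.

Lemma cts_coord (R : realType) (T : topologicalType) n (i : 'I_n)
  (c : T -> 'rV[R]_n) : continuous c -> continuous (fun z => c z 0 i).
Proof.
move=> cc; apply: (@cts_comp _ _ _ (fun M : 'rV[R]_n => M 0 i)) => // z.
exact: coord_continuous.
Qed.

Ltac cts_atom := fail.
Ltac cts1 :=
  match goal with
  | |- _ => cts_atom
  | |- forall i, continuous (@?f i) => intro
  | H : forall i, continuous (?f i) |- continuous (?f _) => exact: H
  | H : forall i j, continuous (?f i j) |- continuous (?f _ _) => exact: H
  | H : continuous ?f |- continuous ?f => exact: H
  | |- continuous (fun z => z) => exact: cts_id
  | |- continuous (fun _ => ?c) => exact: cts_cst
  | |- continuous fst => exact: cts_fst
  | |- continuous snd => exact: cts_snd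
  | |- continuous (fun z => z.1) => exact: cts_fst
  | |- continuous (fun z => z.2) => exact: cts_snd
  | |- continuous (fun z => @fst _ _ (@?f z)) =>
      apply: (cts_comp (@cts_fst _ _) (c := f))
  | |- continuous (fun z => @snd _ _ (@?f z)) =>
      apply: (cts_comp (@cts_snd _ _) (c := f))
  | |- continuous (fun z => (@?f z) ^+ _) => apply: (@ctsX _ _ f)
  | |- continuous (fun z => (@?f z) * (@?g z)) => apply: (@ctsM _ _ f g)
  | |- continuous (fun z => - (@?f z)) => apply: (@ctsN _ _ f)
  | |- continuous (fun z => (@?f z) *: (@?g z)) => apply: (@ctsVZ _ _ _ f g)
  | |- continuous (fun z => (@?f z) + (@?g z)) =>
      first [apply: (@ctsD _ _ f g)|apply: (@ctsVD _ _ _ f g)]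
  | |- continuous (fun z => Num.max (@?f z) (@?g z)) => apply: (@cts_max _ _ f g)
  | |- continuous (fun z => (@?f z, @?g z)) => apply: (@cts_pair _ _ _ _ f g)
  | |- continuous (fun z => \sum_i (@?F z i)) => apply: cts_sum => ?
  | |- continuous (fun z => fun_of_matrix (@?f z) 0 ?i) =>
      apply: (@cts_coord _ _ _ i f)
  | |- continuous (fun z => ?f z) => progress change (continuous f)
  | |- continuous (fun z => ?h (@?c z)) => apply: (@cts_comp _ _ _ h c)
  end.
Ltac cts := repeat cts1.

(** * The mean over the cube as a limit of dyadic Riemann sums *)

Section Grid.
Variables (R : realType) (n : nat).
Implicit Types f g : 'rV[R]_n -> R.

Definition cube : set 'rV[R]_n := [set z | forall i, -1 <= z 0 i <= 1].

Lemma cube_compact : compact cube.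
Proof.
have -> : cube = [set v | forall i : 'I_n, `[-1 : R, 1]%classic (v ord0 i)].
  by apply/seteqP; split => z /= h i; have := h i; rewrite /= in_itv.
by apply: (@rV_compact R n (fun=> `[-1, 1]%classic)) => i; exact: segment_compact.
Qed.

Lemma cube_bounded f : continuous f -> exists M, forall z, cube z -> `|f z| <= M.
Proof.
move=> cf; have c0 : cube !=set0.
  by exists 0 => i; rewrite mxE; apply/andP; split; lra.
have ca : continuous (fun z => `|f z|).
  by move=> z; apply: continuous_comp; [exact: cf|exact: norm_continuous].
have [c _ hc] := compact_EVT_max c0 cube_compact (continuous_subspaceT ca).
by exists `|f c| => z hz; apply: hc; rewrite inE.
Qed.

(** Lower corners of the dyadic cells. The face z_i = 1 is never reached, which suits a cyclic shift
    of the i-th index; dyadic levels are nested, so a cell keeps the same share of the nodes at all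
    finer levels. *)
Definition node m (k : {ffun 'I_n -> 'I_(2 ^ m)}) : 'rV[R]_n :=
  \row_i (-1 + (k i)%:R * (2 / (2 ^ m)%:R)).

Definition riemann m f : R :=
  ((2 ^ m)%:R ^+ n)^-1 * \sum_(k : {ffun 'I_n -> 'I_(2 ^ m)}) f (node k).

Lemma two_expn_gt0 m : 0 < (2 ^ m)%:R :> R.
Proof. by rewrite ltr0n expn_gt0. Qed.

Lemma node_cube m (k : {ffun 'I_n -> 'I_(2 ^ m)}) : cube (node k).
Proof.
move=> i; rewrite mxE; have h := two_expn_gt0 m.
have h1 : (k i)%:R <= (2 ^ m)%:R :> R by rewrite ler_nat ltnW.
have h2 : 0 <= (k i)%:R :> R by [].
rewrite mulrA; apply/andP; split; first by rewrite lerDl divr_ge0 ?mulr_ge0 // ltW.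
have : (k i)%:R * 2 / (2 ^ m)%:R <= 2 :> R by rewrite ler_pdivrMr //; lra.
by lra.
Qed.

Lemma card_nodes m : #|{ffun 'I_n -> 'I_(2 ^ m)}|%:R = (2 ^ m)%:R ^+ n :> R.
Proof. by rewrite card_ffun !card_ord natrX. Qed.

Lemma riemann_le m f g : (forall z, cube z -> f z <= g z) ->
  riemann m f <= riemann m g.
Proof.
move=> h; rewrite ler_pM2l ?invr_gt0 ?exprn_gt0 ?two_expn_gt0 //.
by apply: ler_sum => k _; apply: h; exact: node_cube.
Qed.

Lemma riemann_cst m (c : R) : riemann m (fun=> c) = c.
Proof.
rewrite /riemann sumr_const -[X in _ * X]mulr_natr card_nodes.
by rewrite mulrCA mulVf ?mulr1 // expf_neq0 // gt_eqF ?two_expn_gt0.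
Qed.

Lemma riemann_norm_le m f c : (forall z, cube z -> `|f z| <= c) ->
  `|riemann m f| <= c.
Proof.
move=> h; rewrite ler_norml; apply/andP; split.
  rewrite -(riemann_cst m (- c)); apply: riemann_le => z /h.
  by rewrite ler_norml => /andP[].
rewrite -(riemann_cst m c); apply: riemann_le => z /h.
by rewrite ler_norml => /andP[].
Qed.

Lemma riemannD m f g : riemann m (fun z => f z + g z) = riemann m f + riemann m g.
Proof. by rewrite /riemann big_split /= mulrDr. Qed.

Lemma riemannZ m c f : riemann m (fun z => c * f z) = c * riemann m f.
Proof. by rewrite /riemann -mulr_sumr mulrCA. Qed.

Lemma nat_ultra : {U : set_system nat | UltraFilter U /\ \oo `<=` U}.
Proof. by apply: cid; exact: ultraFilterLemma. Qed.

Local Instance nat_ultra_proper : ProperFilter (sval nat_ultra).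
Proof. by have [uU _] := svalP nat_ultra; exact: ultra_proper. Qed.

(* An ultrafilter limit exists for bounded sums, so that the convergence of the
   Riemann sums need not be discussed. *)
Definition mean f : R := lim (riemann^~ f @ (sval nat_ultra)).

Lemma riemann_cvg f : continuous f -> riemann^~ f @ (sval nat_ultra) --> mean f.
Proof.
move=> /cube_bounded [M hM]; have [uU hU] := svalP nat_ultra.
have hS : (riemann^~ f @ (sval nat_ultra)) `[- M, M]%classic.
  apply: (@filterE _ (sval nat_ultra) _
    (fun m => `[- M, M]%classic (riemann m f))) => m.
  by rewrite /= in_itv /= -ler_norml; exact: riemann_norm_le.
have [p [_ hp]] := @segment_compact R (- M) M _ _ hS.
(* Compactness gives only a cluster point [p]; it is a limit because an ultrafilter contains each
   set or its complement. *)
apply/cvg_ex; exists p => A nA.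
have [//|hA] := in_ultra_setVsetC ((riemann^~ f) @^-1` A) uU.
by have [y [/= yA]] := hp (~` A) A hA nA.
Qed.


Lemma meanE f a : riemann^~ f @ (sval nat_ultra) --> a -> mean f = a.
Proof. by move=> h; apply: (cvg_lim _ h). Qed.

Lemma mean_cst c : mean (fun=> c) = c.
Proof.
apply: meanE; rewrite (_ : (fun m => _) = fun=> c); first exact: cvg_cst.
by apply/funext => m; exact: riemann_cst.
Qed.

Lemma meanD f g : continuous f -> continuous g ->
  mean (fun z => f z + g z) = mean f + mean g.
Proof.
move=> cf cg; apply: meanE.
rewrite (_ : (fun m => _) = fun m => riemann m f + riemann m g).
  by apply: cvgD; exact: riemann_cvg.
by apply/funext => m; exact: riemannD.
Qed.

Lemma meanZ c f : continuous f -> mean (fun z => c * f z) = c * mean f.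
Proof.
move=> cf; apply: meanE.
rewrite (_ : (fun m => _) = fun m => c * riemann m f).
  by apply: cvgMr; exact: riemann_cvg.
by apply/funext => m; exact: riemannZ.
Qed.

Lemma meanN f : continuous f -> mean (fun z => - f z) = - mean f.
Proof. by move=> cf; rewrite -mulN1r -meanZ //; congr mean; apply/funext => z; rewrite mulN1r. Qed.

Lemma meanB f g : continuous f -> continuous g ->
  mean (fun z => f z - g z) = mean f - mean g.
Proof. by move=> cf cg; rewrite meanD ?meanN //; cts. Qed.

Lemma mean_sum (I : finType) (F : I -> 'rV[R]_n -> R) :
  (forall i, continuous (F i)) ->
  mean (fun z => \sum_i F i z) = \sum_i mean (F i).
Proof.
move=> cF; rewrite /index_enum; elim: (locked_with _ _) => [|i s IH].
  by rewrite big_nil -[RHS](mean_cst 0); congr mean; apply/funext => z; rewrite big_nil.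
rewrite big_cons -IH -meanD //.
  by congr mean; apply/funext => z; rewrite big_cons.
exact: cts_sum_seq.
Qed.

Lemma mean_le f g : continuous f -> continuous g ->
  (forall z, cube z -> f z <= g z) -> mean f <= mean g.
Proof.
move=> cf cg h; apply: (ler_cvg_to (riemann_cvg cf) (riemann_cvg cg)).
by apply: filterE => m; exact: riemann_le.
Qed.

Lemma mean_norm_le f c : continuous f -> (forall z, cube z -> `|f z| <= c) ->
  `|mean f| <= c.
Proof.
move=> cf h; apply: cvgr_to_le (cvg_norm (riemann_cvg cf)) _.
by apply: filterE => m; exact: riemann_norm_le.
Qed.

Lemma eq_mean f g : continuous f -> continuous g ->
  (forall z, cube z -> f z = g z) -> mean f = mean g.
Proof.
by move=> cf cg h; apply/eqP; rewrite eq_le; apply/andP; split; apply: mean_le => // z /h ->.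
Qed.

Lemma mean_eq0 f : continuous f -> (forall z, cube z -> f z = 0) -> mean f = 0.
Proof. by move=> cf h; rewrite -(mean_cst 0); apply: eq_mean => //; cts. Qed.

End Grid.

(** * Calculus of one-variable derivatives *)

Section Der.
Variable R : realType.
Implicit Types F G f : R -> R.

Definition der F (s d : R) := is_derive s (1 : R) F d.

Lemma der_of_cvg F s d : h^-1 * (F (h + s) - F s) @[h --> 0^'] --> d -> der F s d.
Proof.
move=> H; have H' : h^-1 *: (F (h *: (1 : R) + s) - F s) @[h --> 0^'] --> d.
  by under eq_fun do rewrite -[_ *: 1]/(_ * 1) mulr1.
apply: DeriveDef; first by apply/cvg_ex; exists d.
exact: cvg_lim H'.
Qed.

Lemma der_cts F f : (forall s, der F s (f s)) -> continuous F.
Proof.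
move=> h s; apply/differentiable_continuous/derivable1_diffP.
by have [] := h s.
Qed.

Lemma der_eq F s d d' : der F s d -> d = d' -> der F s d'.
Proof. by move=> h <-. Qed.

Lemma derC c s : der (fun=> c) s 0.
Proof. exact: is_derive_cst. Qed.

Lemma der_id s : der (fun x => x) s 1.
Proof. exact: is_derive_id. Qed.

Lemma derD F G s d e : der F s d -> der G s e -> der (fun x => F x + G x) s (d + e).
Proof. exact: is_deriveD. Qed.

Lemma derN F s d : der F s d -> der (fun x => - F x) s (- d).
Proof. exact: is_deriveN. Qed.

Lemma derM F G s d e : der F s d -> der G s e ->
  der (fun x => F x * G x) s (d * G s + F s * e).
Proof.
move=> h k; apply: der_eq (is_deriveM h k) _.
by rewrite addrC -!/(_ * _) mulrC.
Qed.

Lemma derZ F c s d : der F s d -> der (fun x => c * F x) s (c * d).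
Proof. by move=> h; apply: der_eq (derM (derC c s) h) _; rewrite mul0r add0r. Qed.

Lemma derX F k s d : der F s d -> der (fun x => F x ^+ k.+1) s (k.+1%:R * F s ^+ k * d).
Proof.
move=> h; elim: k => [|k IH]; first by rewrite expr0 !mul1r.
have -> : (fun x => F x ^+ k.+2) = (fun x => F x * F x ^+ k.+1).
  by apply/funext => x; rewrite exprS.
by apply: der_eq (derM h IH) _; rewrite [in RHS]mulrSr exprS; ring.
Qed.

Lemma der_sum (I : finType) (F : I -> R -> R) (s : R) (d : I -> R) :
  (forall i, der (F i) s (d i)) -> der (fun x => \sum_i F i x) s (\sum_i d i).
Proof.
move=> h; rewrite /index_enum; elim: (locked_with _ _) => [|i r IH].
  by under eq_fun do rewrite big_nil; rewrite big_nil; exact: derC.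
by under eq_fun do rewrite big_cons; rewrite big_cons; exact: derD.
Qed.

Lemma der_comp F G s d e : der F (G s) d -> der G s e ->
  der (fun x => F (G x)) s (d * e).
Proof. exact: is_derive1_comp. Qed.

(** An exponent of at least 2 makes the power of the positive part differentiable across 0; hence
    the exponents [b.+2] on the weights that get differentiated. *)
Lemma der_pos_part k (s : R) :
  der (fun x => Num.max 0 x ^+ k.+2) s (k.+2%:R * Num.max 0 s ^+ k.+1).
Proof.
have [s0|s0|<-] := ltgtP 0 s.
- have h : der (fun x => x ^+ k.+2) s (k.+2%:R * s ^+ k.+1).
    by apply: der_eq (derX k.+1 (der_id s)) _; rewrite mulr1.
  apply: near_eq_is_derive h; near=> x.
  by rewrite max_r //; near: x; exact: lt_le_nbhsr.
- rewrite expr0n /= mulr0.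
  apply: near_eq_is_derive (derC 0 s); near=> x.
  rewrite max_l ?expr0n //; near: x; exact: lt_le_nbhsl.
rewrite expr0n /= mulr0; apply/is_derive1_caratheodory.
exists (fun x => Num.max 0 x ^+ k.+1); split.
- move=> x; rewrite maxxx expr0n /= !subr0 exprSr.
  by case: (ltP 0 x) => // _; rewrite expr0n /= !mul0r.
- have : continuous (fun x : R => Num.max 0 x ^+ k.+1). by cts.
  by apply.
- by rewrite maxxx expr0n.
Unshelve. all: by end_near.
Qed.

End Der.

(** * Uniformity on the cube and differentiation under the mean *)

Section Uniform.
Variables (R : realType) (n : nat).

Lemma cube_uniform (G : R * 'rV[R]_n -> R) (s0 e : R) : continuous G -> 0 < e ->
  exists2 d, 0 < d & forall s z, `|s - s0| < d -> cube z -> `|G (s, z) - G (s0, z)| < e.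
Proof.
move=> cG e0.
have hn : forall x, cube x -> \forall x' \near x & i \near s0,
    `|G (i, x') - G (s0, x')| < e.
  move=> x _; have e2 : 0 < e / 2 by rewrite divr_gt0.
  have /cvgrPdist_lt/(_ _ e2) [[A B] /= [nA nB] AB] := cG (s0, x).
  exists (B, A) => //= -[x' i] [/= Bx' Ai].
  have h1 := AB (i, x') (conj Ai Bx').
  have h2 := AB (s0, x') (conj (nbhs_singleton nA) Bx').
  rewrite (splitr e) -(subrKA (G (s0, x))) (le_lt_trans (ler_normD _ _)) //.
  by apply: ltrD => //; rewrite distrC.
have /compact_near_coveringP/(_ R (nbhs s0)
  (fun s z => `|G (s, z) - G (s0, z)| < e) _ hn) := @cube_compact R n.
move=> /nbhs_ballP[d /= d0 hd]; exists d => // s z sd cz.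
by apply: hd => //; rewrite /ball /= distrC.
Qed.

Lemma line_uniform (g : 'rV[R]_n -> R) (v : 'rV[R]_n) (e : R) : continuous g -> 0 < e ->
  exists2 d, 0 < d & forall s z, `|s| < d -> cube z -> `|g (z + s *: v) - g z| < e.
Proof.
move=> cg e0.
have cG : continuous (fun p : R * 'rV[R]_n => g (p.2 + p.1 *: v)).
  by cts.
have [d d0 h] := cube_uniform 0 cG e0; exists d => // s z sd cz.
by have := h s z; rewrite subr0 /= scale0r addr0; apply.
Qed.

Lemma MVT_norm (F f : R -> R) (a b : R) : (forall s, der F s (f s)) ->
  exists2 c, `|c - a| <= `|b - a| & F b - F a = f c * (b - a).
Proof.
move=> h; have cF := der_cts h.
have [ab|ab|<-] := ltgtP a b; last by exists a; rewrite ?subrr ?mulr0 // normr0.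
- have [] := MVT ab (fun x _ => h x); first exact: continuous_subspaceT.
  move=> c; rewrite in_itv /= => /andP[ac cb] E; exists c => //.
  by rewrite !ger0_norm ?subr_ge0 ?lerD2r ltW.
- have [] := MVT ab (fun x _ => h x); first exact: continuous_subspaceT.
  move=> c; rewrite in_itv /= => /andP[ac cb] E; exists c.
    by rewrite !ler0_norm ?subr_le0 ?lerN2 ?lerD2r ltW.
  by rewrite -[LHS]opprB E; ring.
Qed.

(** By the mean value theorem the difference quotient at z is [G'] at a nearby parameter that
    depends on z; uniformity over the compact cube absorbs this dependence. *)
Lemma mean_is_derive (G G' : R -> 'rV[R]_n -> R) (s : R) :
  (forall s, continuous (G s)) ->
  continuous (fun p : R * 'rV[R]_n => G' p.1 p.2) ->
  (forall s z, der (G^~ z) s (G' s z)) ->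
  der (fun s => mean (G s)) s (mean (G' s)).
Proof.
move=> cG cG' dG.
have cG's t : continuous (G' t).
  exact: (@cts_comp _ _ _ (fun p : R * 'rV[R]_n => G' p.1 p.2) (fun z => (t, z))
    cG' (cts_pair (@cts_cst _ _ t) (@cts_id _))).
apply: der_of_cvg.
apply/cvgrPdist_le => e e0.
have [d d0 hd] := cube_uniform s cG' e0.
near=> h.
have h0 : h != 0 by near: h; exact: nbhs_dnbhs_neq.
have hs : `|h| < d by near: h; apply: dnbhs0_lt.
rewrite -meanB // -meanZ; last by cts.
rewrite -meanB //; last by cts.
apply: mean_norm_le; first by cts.
move=> z cz.
have [c hc ->] := MVT_norm s (h + s) (fun s => dG s z).
rewrite addrK in hc *.
rewrite mulrCA mulVf // mulr1 distrC; apply/ltW/(hd c) => //.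
exact: le_lt_trans hc hs.
Unshelve. all: by end_near.
Qed.
End Uniform.

(** * Integration by parts and definiteness of the mean *)

Section ByParts.
Variables (R : realType) (n : nat).
Implicit Types f g : 'rV[R]_n -> R.

Definition e_ i : 'rV[R]_n := delta_mx 0 i.

Lemma two_inv_expn_small (d : R) : 0 < d -> \forall m \near \oo, 2 / (2 ^ m)%:R < d.
Proof.
move=> d0; have : 2 * (2^-1 ^+ m : R) @[m --> \oo] --> (2 * 0 : R).
  apply: cvgMr; apply: cvg_expr; rewrite ger0_norm ?invr_ge0 //; lra.
rewrite mulr0 => /cvgr0Pnorm_lt/(_ _ d0); apply: filterS => m.
by rewrite exprVn -natrX; apply: le_lt_trans; exact: ler_norm.
Qed.

(* The cyclic shift of the i-th index permutes the nodes; it is the translation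
   by the mesh except on the last layer, which lies one mesh before a face. *)
Lemma riemann_shift m (i : 'I_n) f : (forall z : 'rV[R]_n, z 0 i ^+ 2 = 1 -> f z = 0) ->
  riemann m (fun z => f (z + (2 / (2 ^ m)%:R) *: e_ i)) = riemann m f.
Proof.
move=> f0; congr (_ * _).
pose sh (k : {ffun 'I_n -> 'I_(2 ^ m)}) :=
  [ffun j => if j == i then ordS (k j) else k j].
have shK : injective sh.
  move=> k l /ffunP kl; apply/ffunP => j; move: (kl j); rewrite !ffunE.
  by case: eqP => // _; apply: ordS_inj.
rewrite [RHS](reindex sh) /=; last exact/onW_bij/injF_bij.
apply: eq_bigr => k _.
have h := two_expn_gt0 R m.
have [kl|kl] := ltnP (k i).+1 (2 ^ m).
  congr f; apply/rowP => j; rewrite !mxE !ffunE eqxx /=.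
  have [->|_] := eqVneq j i; last by rewrite mulr0 addr0.
  by rewrite /= modn_small // [in RHS]mulrSr; ring.
have ki : (k i).+1 = (2 ^ m)%N by apply/eqP; rewrite eqn_leq kl ltn_ord.
rewrite !f0 // !mxE ?ffunE eqxx /=.
  by rewrite ki modnn mul0r addr0 sqrrN expr1n.
have -> : (k i)%:R = (2 ^ m)%:R - 1 :> R.
  by have /(congr1 (fun a => a%:R : R)) := ki; rewrite mulrSr => <-; rewrite addrK.
by rewrite eqxx mulr1; field; rewrite gt_eqF.
Qed.

(** With step equal to the mesh, the difference quotient of f has Riemann sum 0 by [riemann_shift],
    and it approximates g uniformly on the cube. *)
Lemma mean_ibp (i : 'I_n) f g : continuous f -> continuous g ->
  (forall z s, der (fun s => f (z + s *: e_ i)) s (g (z + s *: e_ i))) ->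
  (forall z : 'rV[R]_n, z 0 i ^+ 2 = 1 -> f z = 0) -> mean g = 0.
Proof.
move=> cf cg dfg f0.
apply/eqP; rewrite -normr_le0; apply/ler_addgt0Pl => e e0; rewrite addr0.
have [d d0 hd] := line_uniform (e_ i) cg e0.
have [uU hU] := svalP nat_ultra.
have pU := nat_ultra_proper.
have h1 : \forall m \near sval nat_ultra, `|riemann m g| <= e.
  apply: hU; have := two_inv_expn_small d0; apply: filterS => m hm.
  set h := 2 / (2 ^ m)%:R in hm.
  have h0 : 0 < h by rewrite divr_gt0 ?two_expn_gt0.
  have -> : riemann m g = riemann m (fun z => g z +
      - h^-1 * (f (z + h *: e_ i) + (-1) * f z)).
    by rewrite riemannD riemannZ riemannD riemannZ riemann_shift // mulN1r subrr mulr0 addr0.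
  apply: riemann_norm_le => z.
  rewrite mulN1r mulNr; move: z.
  move=> z cz; have [c] := MVT_norm 0 h (dfg z).
    rewrite !subr0 scale0r addr0 => ch ->.
    rewrite mulrCA mulVf ?gt_eqF // mulr1 distrC; apply/ltW/hd => //.
    by rewrite (le_lt_trans ch) // ger0_norm // ltW.
exact: (cvgr_to_le (cvg_norm (riemann_cvg cg)) h1).
Qed.

(** A limit may lose strict positivity, so the Riemann sums need a lower bound uniform in the level:
    the level-j cell of z0, where f is at least c, holds the fraction 1 / (2^j)^n of the nodes at
    every level m >= j. *)
Lemma mean_gt0 f (z0 : 'rV[R]_n) : continuous f -> (forall z, cube z -> 0 <= f z) ->
  (forall i, -1 < z0 0 i < 1) -> 0 < f z0 -> 0 < mean f.
Proof.
move=> cf f0 cz0 fz0.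
pose c := f z0 / 2.
have c0 : 0 < c by rewrite divr_gt0.
have : \forall z \near z0, c < f z.
  have /cvgr_gt/(_ c) := cf z0; apply.
  by rewrite /c ltr_pdivrMr // ltr_pMr // ltr1n.
move=> /nbhs_ballP[d /= d0 hd].
have [j] : exists j, 2 / (2 ^ j)%:R < d.
  have := two_inv_expn_small d0; move=> [N _ hN]; exists N; by apply: hN => /=.
set h := 2 / _ => hd'.
have h0 : 0 < h by rewrite divr_gt0 ?two_expn_gt0.
(* the cell of level j containing z0 *)
pose b i := Num.truncn ((z0 0 i + 1) / h).
have b_ge i : (b i)%:R <= (z0 0 i + 1) / h.
  by rewrite truncn_le // divr_ge0 ?(ltW h0) //; have /andP[] := cz0 i; lra.
have b_lt i : (z0 0 i + 1) / h < (b i).+1%:R.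
  by rewrite truncnS_gt.
have b_bd i : (b i < 2 ^ j)%N.
  rewrite -(ltr_nat R); apply: le_lt_trans (b_ge i) _.
  rewrite ltr_pdivrMr // /h mulrC divfK ?gt_eqF ?two_expn_gt0 //.
  by have /andP[] := cz0 i; lra.
suff : c / (2 ^ j)%:R ^+ n <= mean f.
  by apply: lt_le_trans; rewrite divr_gt0 ?exprn_gt0 ?two_expn_gt0.
have [uU hU] := svalP nat_ultra.
have pU := nat_ultra_proper.
apply: (cvgr_to_ge (riemann_cvg cf)).
apply: hU; exists j => // m /= jm.
(* At level m the cell is cut into [q] parts along each axis; [em] lists the nodes it contains. *)
pose q := (2 ^ (m - j))%N.
have qj : (2 ^ m)%:R = q%:R * (2 ^ j)%:R :> R by rewrite -natrM -expnD subnK.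
have q0 : (0 < q)%N by rewrite expn_gt0.
have lt_emb (l : {ffun 'I_n -> 'I_q}) i : (b i * q + l i < 2 ^ m)%N.
  rewrite -[m](subnK jm) expnD -/q.
  apply: (@leq_trans ((b i).+1 * q)); first by rewrite mulSn addnC ltn_add2r ltn_ord.
  by rewrite mulnC leq_mul2l b_bd orbT.
pose em (l : {ffun 'I_n -> 'I_q}) : {ffun 'I_n -> 'I_(2 ^ m)} :=
  [ffun i => Ordinal (lt_emb l i)].
have em_inj : injective em.
  move=> k l /ffunP kl; apply/ffunP => i; move: (kl i); rewrite !ffunE => -[] /addnI.
  exact: val_inj.
have fem l : c <= f (node R (em l)).
  apply/ltW/hd; split=> // a i; rewrite /ball /= ord1 !mxE ffunE /=.
  set t := (b i * q + l i)%N.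
  have -> : t%:R * (2 / (2 ^ m)%:R) = ((b i)%:R + (l i)%:R / q%:R) * h.
    by rewrite /t natrD natrM qj /h; field; rewrite !gt_eqF ?two_expn_gt0 ?ltr0n.
  have l1 : (l i)%:R / q%:R < 1 :> R by rewrite ltr_pdivrMr ?ltr0n // mul1r ltr_nat.
  have l0 : 0 <= (l i)%:R / q%:R :> R by rewrite divr_ge0.
  have bg := b_ge i; have bl := b_lt i.
  rewrite ler_pdivlMr // in bg; rewrite ltr_pdivrMr // in bl.
  apply: le_lt_trans hd'; rewrite ler_norml.
  have lh0 : 0 <= (l i)%:R / q%:R * h by rewrite mulr_ge0 // ltW.
  have lh1 : (l i)%:R / q%:R * h <= h by rewrite ler_piMl // ltW.
  rewrite -natr1 mulrDl mul1r in bl.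
  by rewrite mulrDl; apply/andP; split; lra.
have -> : c / (2 ^ j)%:R ^+ n = ((2 ^ m)%:R ^+ n)^-1 * \sum_(l : {ffun 'I_n -> 'I_q}) c.
  rewrite sumr_const -[c *+ _]mulr_natr.
  have -> : #|{: {ffun 'I_n -> 'I_q}}|%:R = q%:R ^+ n :> R.
    by rewrite card_ffun !card_ord natrX.
  by rewrite qj exprMn; field; rewrite !expf_neq0 ?gt_eqF ?two_expn_gt0 ?ltr0n.
rewrite /riemann ler_pM2l ?invr_gt0 ?exprn_gt0 ?two_expn_gt0 //.
apply: (@le_trans _ _ (\sum_(l : {ffun 'I_n -> 'I_q}) f (node R (em l)))).
  by apply: ler_sum => l _.
rewrite -(big_imset (fun k => f (node R k)) (in2W em_inj)) /=.
rewrite [leRHS](bigID (fun k => k \in [set em x | x in xpredT]%SET)) /=.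
rewrite lerDl; apply: sumr_ge0 => k _; apply: f0; exact: node_cube.
Qed.
End ByParts.

(** * Smooth functions on spacetime and symmetry of second derivatives *)

Section Spacetime.
Variables (R : realType) (n : nat).
Local Notation ST := (spacetime R n).
Implicit Types (phi u : ST -> R) (p v : ST).

Lemma smooth_cts (phi : ST -> R) : smooth phi -> continuous phi.
Proof. by move=> h; exact: (h 0%N). Qed.

Lemma smooth_diff (phi : ST -> R) p : smooth phi -> differentiable phi p.
Proof. by move=> h; have [] := h 1%N. Qed.

Lemma smooth_D (phi : ST -> R) (v : ST) : smooth phi -> smooth ('D_v phi).
Proof. by move=> h k; have [_ hD] := h k.+1; exact: hD. Qed.
Arguments smooth_D phi v _ : clear implicits.
Arguments smooth_D {phi}.

Lemma smooth_Dcts (phi : ST -> R) (v : ST) : smooth phi -> continuous ('D_v phi).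
Proof. by move=> h; exact/smooth_cts/smooth_D. Qed.
Arguments smooth_Dcts phi v _ : clear implicits.
Arguments smooth_Dcts {phi}.

Lemma der_line (phi : ST -> R) (p v : ST) s : smooth phi ->
  der (fun s => phi (p + s *: v)) s ('D_v phi (p + s *: v)).
Proof.
move=> h; apply: der_of_cvg.
have hd : derivable phi (p + s *: v) v.
  by apply: diff_derivable; exact: smooth_diff.
suff -> : (fun h0 : R => h0^-1 * (phi (p + (h0 + s) *: v) - phi (p + s *: v))) =
  (fun h0 => h0^-1 *: (phi (h0 *: v + (p + s *: v)) - phi (p + s *: v))) by exact: hd.
by apply/funext => t; rewrite scalerDl addrCA.
Qed.

Lemma derive_linear (phi : ST -> R) p (a b : R) (v w : ST) : smooth phi ->
  'D_(a *: v + b *: w) phi p = a * 'D_v phi p + b * 'D_w phi p.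
Proof.
move=> h; have d := smooth_diff p h.
by rewrite !deriveE // linearD !linearZ.
Qed.

Lemma derive_sumv (phi : ST -> R) p (I : finType) (a : I -> R) (v : I -> ST) : smooth phi ->
  'D_(\sum_i a i *: v i) phi p = \sum_i a i * 'D_(v i) phi p.
Proof.
move=> h; have d := smooth_diff p h.
rewrite deriveE // linear_sum; apply: eq_bigr => i _.
by rewrite linearZ deriveE.
Qed.

Lemma line_nbhs (f : ST -> R) p (v w : ST) e : continuous f -> 0 < e ->
  exists2 d, 0 < d & forall a b : R, `|a| <= d -> `|b| <= d ->
    `|f (p + a *: v + b *: w) - f p| < e.
Proof.
move=> cf e0.
have cg : continuous (fun q : R * R => f (p + q.1 *: v + q.2 *: w)).
  by cts.
have /cvgrPdist_lt/(_ _ e0) := cg (0, 0).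
move=> /nbhs_ballP[d /= d0 hd]; exists (d / 2); first by rewrite divr_gt0.
move=> a b ha hb; have := hd (a, b).
rewrite /= !scale0r !addr0 distrC; apply; rewrite /ball /=; split => /=.
  by rewrite /ball /= sub0r normrN (le_lt_trans ha) // ltr_pdivrMr // ltr_pMr // ltr1n.
by rewrite /ball /= sub0r normrN (le_lt_trans hb) // ltr_pdivrMr // ltr_pMr // ltr1n.
Qed.

(* Both mixed derivatives are limits of the second difference quotient over a
   small square. *)
Lemma derive_comm (phi : ST -> R) (v w : ST) p : smooth phi ->
  'D_v ('D_w phi) p = 'D_w ('D_v phi) p.
Proof.
have key (v1 w1 : ST) e : smooth phi -> 0 < e -> exists2 d, 0 < d &
    forall h, 0 < h <= d ->
    `|(phi (p + h *: v1 + h *: w1) - phi (p + h *: v1) - phi (p + h *: w1) + phi p)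
      / h ^+ 2 - 'D_w1 ('D_v1 phi) p| < e.
  move=> sp e0.
  have [d d0 hd] := line_nbhs p v1 w1 (smooth_Dcts w1 (smooth_D v1 sp)) e0.
  exists d => // h /andP[h0 hle].
  have dF s : der (fun s => phi (p + h *: w1 + s *: v1) - phi (p + s *: v1)) s
      ('D_v1 phi (p + h *: w1 + s *: v1) - 'D_v1 phi (p + s *: v1)).
    by apply: derD; [exact: der_line|apply: derN; exact: der_line].
  have [a ha E] := MVT_norm 0 h dF.
  have [b hb E2] := MVT_norm 0 h (fun s => der_line (p + a *: v1) w1 s (smooth_D v1 sp)).
  rewrite !scale0r !addr0 !subr0 in E E2 ha hb.
  have -> : (phi (p + h *: v1 + h *: w1) - phi (p + h *: v1) - phi (p + h *: w1) + phi p)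
      / h ^+ 2 = 'D_w1 ('D_v1 phi) (p + a *: v1 + b *: w1).
    rewrite [p + h *: v1 + h *: w1]addrAC.
    transitivity ((phi (p + h *: w1 + h *: v1) - phi (p + h *: v1) - (phi (p + h *: w1) - phi p))
       / h ^+ 2); first by congr (_ / _); ring.
    rewrite E [p + h *: w1 + a *: v1]addrAC E2.
    by field; rewrite gt_eqF.
  rewrite (ger0_norm (ltW h0)) in ha hb.
  by apply: hd; [exact: le_trans ha hle|exact: le_trans hb hle].
move=> sp; apply/eqP; rewrite -subr_eq0 -normr_le0.
apply/ler_addgt0Pl => e e0; rewrite addr0.
have e2 : 0 < e / 2 by rewrite divr_gt0.
have [d1 d10 h1] := key w v _ sp e2.
have [d2 d20 h2] := key v w _ sp e2.
pose h := Num.min d1 d2.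
have h0 : 0 < h by rewrite lt_min d10.
have {}h1 := h1 h; have {}h2 := h2 h.
rewrite h0 ge_min lexx /= in h1; rewrite h0 ge_min lexx orbT /= in h2.
have {}h1 := h1 isT; have {}h2 := h2 isT.
set q2 := (_ / _) in h2.
have E : (phi (p + h *: w + h *: v) - phi (p + h *: w) - phi (p + h *: v) + phi p)
      / h ^+ 2 = q2.
  by rewrite /q2 [p + h *: w + h *: v]addrAC; congr (_ / _); ring.
rewrite E in h1; clearbody q2.
move: h1 h2; move: ('D_v ('D_w phi) p) ('D_w ('D_v phi) p) => A1 A2 h1 h2.
rewrite (splitr e) -(subrKA q2) (le_trans (ler_normD _ _)) //.
by apply: lerD; apply: ltW => //; rewrite distrC.
Qed.

End Spacetime.

Lemma MVT_in (R : realType) (F f : R -> R) (a b : R) : a <= b ->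
  (forall s, a <= s <= b -> der F s (f s)) ->
  exists2 c, a <= c <= b & F b - F a = f c * (b - a).
Proof.
move=> ab h.
have cF : {within `[a, b], continuous F}.
  apply: continuous_in_subspaceT => s; rewrite inE /= in_itv /= => sab.
  apply/differentiable_continuous/derivable1_diffP.
  by have [] := h s sab.
have dF x : x \in `]a, b[ -> is_derive x (1 : R) F (f x).
  by rewrite in_itv /= => /andP[ax xb]; apply: h; rewrite !ltW.
have [c] := MVT_segment ab dF cF.
by rewrite in_itv /=; exists c.
Qed.

Lemma der_near0 (R : realType) (F : R -> R) s d : der F s d ->
  (\forall x \near s, F x = 0) -> d = 0.
Proof.
move=> [_ <-] h.
have h' : \forall x \near s, cst 0 x = F x by apply: filterS h => x ->.
by have [_ ->] := near_eq_is_derive h' (is_derive_cst 0 s (1 : R)).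
Qed.

(** * The truncated weight and integration by parts against it *)

Section Weight.
Variables (R : realType) (n : nat).
Implicit Types (y z : 'rV[R]_n) (G : 'rV[R]_n -> R).

Definition sqn z : R := \sum_i z 0 i ^+ 2.

Lemma sqn_ge0 z : 0 <= sqn z.
Proof. by apply: sumr_ge0 => i _; exact: sqr_ge0. Qed.

Lemma sqn_coord z i : z 0 i ^+ 2 <= sqn z.
Proof.
by rewrite /sqn (bigD1 i) //= lerDl; apply: sumr_ge0 => j _; exact: sqr_ge0.
Qed.

Lemma sqnZ c z : sqn (c *: z) = c ^+ 2 * sqn z.
Proof. by rewrite /sqn mulr_sumr; apply: eq_bigr => i _; rewrite mxE exprMn. Qed.

Lemma cts_sqn : continuous sqn.
Proof. by rewrite /sqn; cts. Qed.

Lemma sqn_lt1_coord z i : sqn z < 1 -> -1 < z 0 i < 1.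
Proof.
move=> h; rewrite -ltr_norml -(@ltr_pXn2r _ 2) ?nnegrE // ?expr1n.
by rewrite real_normK ?num_real // (le_lt_trans (sqn_coord z i)).
Qed.

(** The triangle inequality in squared form. Expanding |y - a z|^2 >= 0 bounds the inner product of
    y and z by a, in place of Cauchy-Schwarz. *)
Lemma sqnD_lt (a e : R) y z : 0 < a -> 0 <= e -> sqn y < a ^+ 2 -> sqn z <= 1 ->
  sqn (y + e *: z) < (a + e) ^+ 2.
Proof.
move=> a0 e0 ya z1.
have E : sqn (y + e *: z) = sqn y + 2 * e * (\sum_i y 0 i * z 0 i) + e ^+ 2 * sqn z.
  rewrite /sqn !mulr_sumr -!big_split /=; apply: eq_bigr => i _.
  by rewrite !mxE; ring.
have h : 0 <= sqn y - 2 * a * (\sum_i y 0 i * z 0 i) + a ^+ 2 * sqn z.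
  have -> : sqn y - 2 * a * (\sum_i y 0 i * z 0 i) + a ^+ 2 * sqn z
      = \sum_i (y 0 i - a * z 0 i) ^+ 2.
    rewrite /sqn !mulr_sumr -sumrN -!big_split /=; apply: eq_bigr => i _; ring.
  by apply: sumr_ge0 => i _; exact: sqr_ge0.
have a2 : a ^+ 2 * sqn z <= a ^+ 2 by rewrite ler_piMr ?sqr_ge0.
have e2 : e ^+ 2 * sqn z <= e ^+ 2 by rewrite ler_piMr ?sqr_ge0.
set S := \sum_i _ in E h.
have Sa : S <= a.
  have : a * S <= a * a by rewrite expr2 in ya a2; lra.
  by rewrite ler_pM2l.
have : e * S <= e * a by rewrite ler_wpM2l.
by rewrite E; rewrite !expr2 in ya e2 *; lra.
Qed.

(** Truncating at zero turns means over balls into means over the cube. *)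
Definition wt (rho : R) z : R := Num.max 0 (rho - sqn z).

Lemma wt_ge0 rho z : 0 <= wt rho z.
Proof. by rewrite le_max lexx. Qed.

Lemma cts_wt rho : continuous (wt rho).
Proof. by have c := cts_sqn; rewrite /wt; cts. Qed.

Lemma wt_gt0 rho z : (0 < wt rho z) = (sqn z < rho).
Proof. by rewrite lt_max ltxx subr_gt0. Qed.

Lemma wt_eq0 rho z : rho <= sqn z -> wt rho z = 0.
Proof. by move=> h; rewrite /wt max_l // subr_le0. Qed.

Lemma der_coord z i j (s : R) : der (fun s => (z + s *: e_ R j) 0 i) s (i == j)%:R.
Proof.
have -> : (fun s => (z + s *: e_ R j) 0 i) = (fun s => z 0 i + s * (i == j)%:R).
  by apply/funext => t; rewrite !mxE.
apply: der_eq (derD (derC _ s) (derM (der_id s) (derC (i == j)%:R s))) _.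
by rewrite mul1r mulr0 addr0 add0r.
Qed.

Lemma der_sqn_line z i (s : R) :
  der (fun s => sqn (z + s *: e_ R i)) s (2 * (z + s *: e_ R i) 0 i).
Proof.
have h (j : 'I_n) : der (fun s => (z + s *: e_ R i) 0 j ^+ 2) s
    (2 * (z + s *: e_ R i) 0 j * (j == i)%:R).
  by apply: der_eq (derX 1 (der_coord z j i s)) _; rewrite expr1.
apply: der_eq (der_sum h) _.
rewrite (bigD1 i) //= eqxx mulr1 big1 ?addr0 // => j /negPf ->.
by rewrite mulr0.
Qed.

Lemma der_wt_line rho b z i (s : R) :
  der (fun s => wt rho (z + s *: e_ R i) ^+ b.+2) s
    (- (2 * b.+2%:R) * ((z + s *: e_ R i) 0 i * wt rho (z + s *: e_ R i) ^+ b.+1)).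
Proof.
have h := derD (derC rho s) (derN (der_sqn_line z i s)).
by apply: der_eq (der_comp (@der_pos_part R b _) h) _; rewrite /wt; ring.
Qed.

(** Inside the ball the weight has gradient -2z, so a derivative is traded for a factor z_i and one
    power of the weight. For [rho <= 1] the weight vanishes on the faces of the cube, so no boundary
    term remains. *)
Lemma wt_ibp rho b i G G' : rho <= 1 -> continuous G -> continuous G' ->
  (forall z s, der (fun s => G (z + s *: e_ R i)) s (G' (z + s *: e_ R i))) ->
  mean (fun z => wt rho z ^+ b.+2 * G' z) =
  2 * b.+2%:R * mean (fun z => z 0 i * wt rho z ^+ b.+1 * G z).
Proof.
move=> r1 cG cG' dG; have cw := @cts_wt rho.
apply/eqP; rewrite -subr_eq0 -meanZ; last by cts.
rewrite -meanB; try by cts.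
apply/eqP; apply: (@mean_ibp _ _ i (fun z => wt rho z ^+ b.+2 * G z)); try by cts.
  move=> z s; apply: der_eq (derM (der_wt_line rho b z i s) (dG z s)) _.
  by ring.
move=> z zi; rewrite wt_eq0 ?expr0n /= ?mul0r //.
by apply: le_trans r1 _; rewrite -zi sqn_coord.
Qed.

End Weight.

(** * Gradients and derivatives along affine lines *)

Section SpaceDerivatives.
Variables (R : realType) (n : nat).
Local Notation ST := (spacetime R n).
Implicit Types (y z x : 'rV[R]_n) (t s r : R).

Lemma der_affine (phi : ST -> R) (c : R -> ST) (p v : ST) s : smooth phi ->
  (forall s, c s = p + s *: v) -> der (fun s => phi (c s)) s ('D_v phi (c s)).
Proof.
move=> h E; have -> : (fun s => phi (c s)) = (fun s => phi (p + s *: v)).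
  by apply/funext => ?; rewrite E.
by rewrite E; exact: der_line.
Qed.

Lemma derive_coord (phi : ST -> R) (p : ST) (a : R) (w : 'rV[R]_n) : smooth phi ->
  'D_((a, w) : ST) phi p = a * dt phi p + \sum_i w 0 i * dx i phi p.
Proof.
move=> h.
have -> : ((a, w) : ST) = a *: e_t R n + 1 *: \sum_i w 0 i *: e_x R i.
  rewrite scale1r; apply/pair_equal_spec; split => /=.
    rewrite -[_ *: 1]/(a * 1) mulr1.
    have -> : (\sum_i w 0 i *: e_x R i : ST).1 = \sum_i (w 0 i *: e_x R i : ST).1.
      by apply: (big_morph (fun q : ST => q.1)).
    by rewrite big1 ?addr0 // => i _ /=; rewrite scaler0.
  rewrite scaler0 add0r.
  have -> : (\sum_i w 0 i *: e_x R i : ST).2 = \sum_i (w 0 i *: e_x R i : ST).2.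
    by apply: (big_morph (fun q : ST => q.2)).
  exact: row_sum_delta.
by rewrite derive_linear // mul1r derive_sumv.
Qed.

Lemma smooth_dt (phi : ST -> R) : smooth phi -> smooth (dt phi).
Proof. exact: smooth_D. Qed.

Lemma smooth_dx (phi : ST -> R) i : smooth phi -> smooth (dx i phi).
Proof. exact: smooth_D. Qed.

Lemma dt_dx (phi : ST -> R) i p : smooth phi -> dt (dx i phi) p = dx i (dt phi) p.
Proof. exact: derive_comm. Qed.

(* The partial derivatives are carried as separate functions: the 'D_v f are
   costly to compare up to conversion. *)
Definition has_gradient (f ft : ST -> R) (fx : 'I_n -> ST -> R) : Prop :=
  [/\ continuous f, continuous ft, (forall i, continuous (fx i)) &
  forall (c : R -> ST) (p : ST) (a : R) (v : 'rV[R]_n) s,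
    (forall s, c s = p + s *: ((a, v) : ST)) ->
    der (fun s => f (c s)) s (a * ft (c s) + \sum_i v 0 i * fx i (c s))].

Lemma smooth_has_gradient (phi : ST -> R) : smooth phi ->
  has_gradient phi (dt phi) (fun i => dx i phi).
Proof.
move=> h; split.
- exact: smooth_cts.
- exact/smooth_cts/smooth_dt.
- by move=> i; exact/smooth_cts/smooth_dx.
- move=> c p a v s hc; apply: der_eq (der_affine s h hc) _.
  exact: derive_coord.
Qed.

Lemma der_space_line f ft fx t y r z i s : has_gradient f ft fx ->
  der (fun s => f (t, y + r *: (z + s *: e_ R i))) s
    (r * fx i (t, y + r *: (z + s *: e_ R i))).
Proof.
move=> [_ _ _ h].
have h1 : forall s, ((t, y + r *: (z + s *: e_ R i)) : ST) =
    (t, y + r *: z) + s *: ((0, r *: e_ R i) : ST).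
  move=> s'; apply/pair_equal_spec; split => /=; first by rewrite scaler0 addr0.
  by rewrite scalerDr addrA !scalerA mulrC.
apply: der_eq (h _ _ _ _ s h1) _; rewrite mul0r add0r.
rewrite (bigD1 i) //= !mxE !eqxx mulr1 big1 ?addr0 // => j /negPf ji.
by rewrite !mxE ji mulr0 mul0r.
Qed.

End SpaceDerivatives.

Lemma cts_spacetime (R : realType) n (T : topologicalType) (a : T -> R)
  (b : T -> 'rV[R]_n) : continuous a -> continuous b ->
  continuous ((fun z => (a z, b z)) : T -> spacetime R n).
Proof. exact: cts_pair. Qed.

Ltac cts_atom ::=
  match goal with
  | |- continuous (wt _) => exact: cts_wt
  | |- continuous (fun z => (@?f z, @?g z)) => apply: (@cts_spacetime _ _ _ f g)
  | |- continuous (@sqn _ _) => exact: cts_sqn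
  end.

(** * Pointwise algebra for the energy and the characteristics *)

Section PointwiseAlgebra.
Variables (R : realType) (n : nat).
Implicit Types (zz ux : 'I_n -> R) (a sg w ut : R).

(* Cauchy-Schwarz inside the cone of height a: the defect is a sum of squares. *)
Lemma flux_le_energy zz ux a sg ut : 0 < a -> sg ^+ 2 = 1 ->
  \sum_i zz i ^+ 2 < a ^+ 2 ->
  0 <= a * (ut ^+ 2 + \sum_i ux i ^+ 2) - 2 * sg * \sum_i zz i * (ut * ux i).
Proof.
move=> a0 sg2 za; rewrite -(pmulr_rge0 _ a0).
have -> : a * (a * (ut ^+ 2 + \sum_i ux i ^+ 2) - 2 * sg * \sum_i zz i * (ut * ux i)) =
   (a ^+ 2 - \sum_i zz i ^+ 2) * ut ^+ 2 + \sum_i (a * ux i - sg * zz i * ut) ^+ 2.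
  have -> : \sum_i (a * ux i - sg * zz i * ut) ^+ 2 =
     a ^+ 2 * (\sum_i ux i ^+ 2) - 2 * sg * a * (\sum_i zz i * (ut * ux i))
      + (\sum_i zz i ^+ 2) * ut ^+ 2.
    rewrite mulr_suml !mulr_sumr -sumrN -!big_split /=; apply: eq_bigr => i _.
    rewrite sqrrB; have -> : (sg * zz i * ut) ^+ 2 = zz i ^+ 2 * ut ^+ 2.
      by rewrite !exprMn sg2 mul1r.
    by ring.
  by ring.
apply: addr_ge0; last by apply: sumr_ge0 => i _; exact: sqr_ge0.
by apply: mulr_ge0; [rewrite subr_ge0 ltW|exact: sqr_ge0].
Qed.

(** The section of the cone shrinks at the speed of propagation, which loses at least the energy
    that the flux can bring in. The weight enters squared, so its sign is irrelevant. *)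
Lemma energy_flux_le0 zz ux a sg ut w : sg ^+ 2 = 1 -> 0 <= a ->
  (a ^+ 2 <= \sum_i zz i ^+ 2 -> w = 0) ->
  - 6 * a * w ^+ 2 * (ut ^+ 2 + \sum_i ux i ^+ 2) +
  2 * sg * 6 * \sum_i zz i * w ^+ 2 * (ut * ux i) <= 0.
Proof.
move=> sg2 a0 w0.
have -> : \sum_i zz i * w ^+ 2 * (ut * ux i) = w ^+ 2 * \sum_i zz i * (ut * ux i).
  by rewrite mulr_sumr; apply: eq_bigr => i _; ring.
have [h|h] := leP (a ^+ 2) (\sum_i zz i ^+ 2).
  by rewrite w0 // expr0n /= !mul0r !mulr0 mul0r addr0.
have a1 : 0 < a.
  rewrite lt_def a0 andbT; apply: contraTneq h => ->.
  by rewrite expr0n /= -leNgt sumr_ge0 // => i _; exact: sqr_ge0.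
have := flux_le_energy ux ut a1 sg2 h.
move: (\sum_i zz i * _) (\sum_i ux i ^+ 2) => S2 S1 h1.
have : 0 <= 6 * w ^+ 2 * (a * (ut ^+ 2 + S1) - 2 * sg * S2).
  by apply: mulr_ge0 => //; rewrite mulr_ge0 ?sqr_ge0.
by lra.
Qed.

(** Weighted form of ut Lap(u) + grad(u).grad(ut) = div(ut grad(u)); the factor [rad] comes from the
    rescaled space variable. *)
Lemma energy_source zz ux (uxt : 'I_n -> R) (uxx : 'I_n -> R) sg rad w ut :
  w * (2 * sg * rad * (ut * (\sum_i uxx i) + \sum_i ux i * uxt i)) =
  2 * sg * \sum_i w * (rad * uxt i * ux i + ut * (rad * uxx i)).
Proof.
rewrite (mulr_sumr _ _ _ ut) -big_split /= !mulr_sumr; apply: eq_bigr => i _.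
by ring.
Qed.

(** Differentiating u_t + sg u_r along (-sg, 1): the mixed derivatives cancel since sg^2 = 1, and
    the wave equation replaces u_tt by the trace of D. *)
Lemma char_algebra w sg zz (D : 'I_n -> 'I_n -> R) (uxt : 'I_n -> R) utt :
  sg ^+ 2 = 1 -> \sum_i D i i = utt ->
  w * ((- sg * utt + \sum_j zz j * uxt j) +
    sg * \sum_i zz i * (- sg * uxt i + \sum_j zz j * D i j)) =
  sg * (\sum_i \sum_j w * (zz i * zz j * D i j) - \sum_i w * D i i).
Proof.
move=> sg2 <-.
have -> : \sum_i zz i * (- sg * uxt i + \sum_j zz j * D i j) =
    - sg * (\sum_j zz j * uxt j) + \sum_i \sum_j zz i * zz j * D i j.
  rewrite mulr_sumr -big_split /=; apply: eq_bigr => i _.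
  rewrite mulrDr mulrCA; congr (_ + _).
  by rewrite mulr_sumr; apply: eq_bigr => j _; rewrite mulrA.
have -> : \sum_i \sum_j w * (zz i * zz j * D i j) = w * \sum_i \sum_j zz i * zz j * D i j.
  by rewrite mulr_sumr; apply: eq_bigr => i _; rewrite mulr_sumr.
rewrite -(mulr_sumr _ _ _ w).
move: (\sum_i D i i) (\sum_j zz j * uxt j) (\sum_i \sum_j _) => S1 S2 S3.
by rewrite mulrDr [sg * (_ + _)]mulrDr [sg * (- sg * _)]mulrA mulrN -expr2 sg2; ring.
Qed.

End PointwiseAlgebra.

(** * The energy estimate in a cone *)

Section Energy.
Variables (R : realType) (n : nat).
Local Notation ST := (spacetime R n).
Variables (u ut utt : ST -> R) (ux uxt : 'I_n -> ST -> R).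
Variable uxx : 'I_n -> 'I_n -> ST -> R.
Hypotheses (gu : has_gradient u ut ux) (gt : has_gradient ut utt uxt).
Hypotheses (gx : forall i, has_gradient (ux i) (uxt i) (uxx i)).
Hypothesis wave : forall p, \sum_i uxx i i p = utt p.
Variables (t0 rad sg : R).
Hypotheses (rad0 : 0 < rad) (sg2 : sg ^+ 2 = 1).
Hypothesis data0 : forall x, sqn x < rad ^+ 2 -> u (t0, x) = 0 /\ ut (t0, x) = 0.
(* The summand 0 is the centre y of der_space_line. *)
Local Notation pt s z := (((t0 + sg * rad * s, 0 + rad *: z) : ST)).
Implicit Types (z : 'rV[R]_n) (s : R).

Let cu : continuous u. Proof. by case: gu. Qed.
Let cut : continuous ut. Proof. by case: gu. Qed.
Let cutt : continuous utt. Proof. by case: gt. Qed.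
Let cux i : continuous (ux i). Proof. by case: (gx i). Qed.
Let cuxt i : continuous (uxt i). Proof. by case: (gx i). Qed.
Let cuxx i j : continuous (uxx i j). Proof. by case: (gx i). Qed.

Definition energy_density (p : ST) : R := ut p ^+ 2 + \sum_i ux i p ^+ 2.

Lemma energy_density_ge0 p : 0 <= energy_density p.
Proof. by rewrite addr_ge0 ?sqr_ge0 ?sumr_ge0 // => i _; exact: sqr_ge0. Qed.

Lemma der_time f ft fx z s : has_gradient f ft fx ->
  der (fun s => f (pt s z)) s (sg * rad * ft (pt s z)).
Proof.
move=> [_ _ _ h].
have h1 : forall s, pt s z = (t0, 0 + rad *: z) + s *: ((sg * rad, 0) : ST).
  move=> s'; apply/pair_equal_spec; split => /=; last by rewrite scaler0 addr0.
  by rewrite -[_ *: (_ * _)]/(s' * (sg * rad)); ring.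
apply: der_eq (h _ _ _ _ s h1) _; rewrite big1 ?addr0 // => i _.
by rewrite mxE mul0r.
Qed.

(** The cone is rescaled so that its section at parameter s is |z| < 1 - s. From the cubed weight,
    one derivative in s or one integration by parts leaves the square needed by
    [energy_flux_le0]. *)
Definition energy s : R :=
  mean (fun z => wt ((1 - s) ^+ 2) z ^+ 3 * energy_density (pt s z)).

Let denergy s z : R :=
  - 6 * (1 - s) * wt ((1 - s) ^+ 2) z ^+ 2 * energy_density (pt s z) +
  wt ((1 - s) ^+ 2) z ^+ 3 * (2 * sg * rad *
    (ut (pt s z) * utt (pt s z) + \sum_i ux i (pt s z) * uxt i (pt s z))).

Lemma cts_energy_density : continuous energy_density.
Proof. by rewrite /energy_density; cts. Qed.

Lemma der_energy s : der energy s (mean (denergy s)).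
Proof.
have c1 := cts_energy_density.
have c6 := @cts_sqn R n.
apply: (@mean_is_derive _ _ _ denergy).
- by move=> a; have c7 := @cts_wt R n ((1 - a) ^+ 2); cts.
- by rewrite /denergy /wt; cts.
move=> a z.
have h1 : der (fun a => wt ((1 - a) ^+ 2) z ^+ 3) a
    (- 6 * (1 - a) * wt ((1 - a) ^+ 2) z ^+ 2).
  have h := derD (derX 1 (derD (derC 1 a) (derN (der_id a)))) (derC (- sqn z) a).
  by apply: der_eq (der_comp (@der_pos_part R 1 _) h) _; rewrite /wt expr1; ring.
have h2 : der (fun a => energy_density (pt a z)) a (2 * sg * rad *
    (ut (pt a z) * utt (pt a z) + \sum_i ux i (pt a z) * uxt i (pt a z))).
  have h3 := derD (derX 1 (der_time z a gt))
    (der_sum (fun i => derX 1 (der_time z a (gx i)))).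
  apply: der_eq h3 _; rewrite !expr1 mulrDr mulr_sumr; congr (_ + _); first by ring.
  by apply: eq_bigr => i _; rewrite expr1; ring.
exact: der_eq (derM h1 h2) _.
Qed.

Lemma denergy_le0 s : 0 <= s <= 1 -> mean (denergy s) <= 0.
Proof.
move=> /andP[s0 s1].
have c1 := cts_energy_density.
have c7 := @cts_wt R n ((1 - s) ^+ 2).
have rho1 : (1 - s) ^+ 2 <= 1 by rewrite expr_le1 //; lra.
pose G i z := ut (pt s z) * ux i (pt s z).
pose G' i z := rad * uxt i (pt s z) * ux i (pt s z) +
   ut (pt s z) * (rad * uxx i i (pt s z)).
have cG i : continuous (G i) by rewrite /G; cts.
have cG' i : continuous (G' i) by rewrite /G'; cts.
pose a1 z := - 6 * (1 - s) * wt ((1 - s) ^+ 2) z ^+ 2 * energy_density (pt s z).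
have ca1 : continuous a1 by rewrite /a1; cts.
(* The wave equation makes the source term a divergence, ready for [wt_ibp]. *)
have -> : denergy s =
    (fun z => a1 z + 2 * sg * \sum_i wt ((1 - s) ^+ 2) z ^+ 3 * G' i z).
  apply/funext => z; rewrite /denergy -/(a1 z); congr (_ + _).
  by rewrite -wave -energy_source.
rewrite meanD ?meanZ ?mean_sum; try by cts.
have -> : \sum_i mean (fun z => wt ((1 - s) ^+ 2) z ^+ 3 * G' i z) =
    \sum_i 6 * mean (fun z => z 0 i * wt ((1 - s) ^+ 2) z ^+ 2 * G i z).
  apply: eq_bigr => i _; rewrite (wt_ibp (i := i) 1 rho1 (cG i) (cG' i)).
    by congr (_ * _); ring.
  move=> z a; rewrite /G /G'.
  exact: derM (der_space_line _ _ _ _ _ _ gt) (der_space_line _ _ _ _ _ _ (gx i)).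
rewrite -mulr_sumr -mean_sum; last by cts.
rewrite mulrA -meanZ -?meanD; try by cts.
rewrite -[leRHS](mean_cst n 0); apply: mean_le; try by cts.
move=> z _; rewrite /a1 /G /energy_density.
apply: energy_flux_le0 => //; first by rewrite subr_ge0.
exact: wt_eq0.
Qed.

Lemma data_dx0 x i : sqn x < rad ^+ 2 -> ux i (t0, x) = 0.
Proof.
move=> hx.
have h := der_space_line t0 0 1 x i 0 gu.
rewrite scale0r addr0 scale1r add0r mul1r in h.
apply: (der_near0 h).
have c : continuous (fun s : R => sqn (x + s *: e_ R i)).
  by have := @cts_sqn R n => ?; cts.
have /cvgr_lt/(_ (rad ^+ 2)) := c 0; rewrite scale0r addr0 => /(_ hx).
apply: filterS => s hs; rewrite scale1r add0r; exact: (data0 hs).1.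
Qed.

Lemma energy0 : energy 0 = 0.
Proof.
have c1 := cts_energy_density; have c7 := @cts_wt R n ((1 - 0) ^+ 2).
rewrite /energy; apply: mean_eq0; first by cts.
move=> z _; have [ws|ws] := leP 1 (sqn z).
  by rewrite wt_eq0 ?expr0n ?mul0r // subr0 expr1n.
have hx : sqn (rad *: z) < rad ^+ 2 by rewrite sqnZ gtr_pMr // exprn_gt0.
rewrite /energy_density mulr0 addr0 add0r (data0 hx).2 expr0n /= add0r.
rewrite big1 ?mulr0 // => i _; by rewrite data_dx0 // expr0n.
Qed.

Lemma energy_density_eq0 s z : 0 <= s < 1 -> sqn z < (1 - s) ^+ 2 ->
  energy_density (pt s z) = 0.
Proof.
move=> /andP[s0 s1] hz; apply/eqP; apply: contraTT isT => ne.
have c1 := cts_energy_density; have c7 := @cts_wt R n ((1 - s) ^+ 2).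
have : 0 < energy s.
  rewrite /energy; apply: (@mean_gt0 _ _ _ z); first by cts.
  - by move=> x _; rewrite mulr_ge0 ?exprn_ge0 ?wt_ge0 ?energy_density_ge0.
  - move=> i; apply: sqn_lt1_coord; apply: lt_le_trans hz _.
    by rewrite expr_le1 //; lra.
  by rewrite mulr_gt0 ?exprn_gt0 ?wt_gt0 // lt_def ne energy_density_ge0.
(* The energy starts at 0 with nonpositive slope, so it cannot be positive at s. *)
have [c /andP[c0 cs] E] := MVT_in s0 (fun s _ => der_energy s).
rewrite energy0 !subr0 in E; rewrite E ltNge mulr_le0_ge0 //.
by apply: denergy_le0; rewrite c0 (le_trans cs (ltW s1)).
Qed.

Lemma energy_density_eq0P p : energy_density p = 0 ->
  ut p = 0 /\ forall i, ux i p = 0.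
Proof.
have S0 : 0 <= \sum_i ux i p ^+ 2 by apply: sumr_ge0 => i _; exact: sqr_ge0.
move/eqP; rewrite (paddr_eq0 (sqr_ge0 _) S0) sqrf_eq0 => /andP[/eqP h1 /eqP h2].
split=> // i; apply/eqP; rewrite -sqrf_eq0; apply/eqP.
by apply: (psumr_eq0P _ h2) => // j _; exact: sqr_ge0.
Qed.

(** The energy controls only the derivatives of u; the value of u is recovered along the time
    segment from the base, which stays in the cone. *)
Lemma cone_vanish s z : 0 <= s < 1 -> sqn z < (1 - s) ^+ 2 ->
  [/\ u (pt s z) = 0, ut (pt s z) = 0 & forall i, ux i (pt s z) = 0].
Proof.
move=> /[dup] h01 /andP[s0 s1] hz.
have [h1 h2] := energy_density_eq0P (energy_density_eq0 h01 hz); split=> //.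
have [c /andP[c0 cs] E] := MVT_in s0 (fun s _ => der_time z s gu).
have hc : energy_density (pt c z) = 0.
  apply: energy_density_eq0; first by rewrite c0 (le_lt_trans cs).
  by apply: lt_le_trans hz _; rewrite ler_sqr ?nnegrE; lra.
rewrite (energy_density_eq0P hc).1 mulr0 mul0r in E.
move/eqP: E; rewrite subr_eq0 => /eqP ->; rewrite add0r.
rewrite addr0; apply: (data0 _).1; rewrite sqnZ gtr_pMr ?exprn_gt0 //.
by apply: lt_le_trans hz _; rewrite expr_le1 //; lra.
Qed.
End Energy.

(** * Domain of dependence for smooth solutions *)

Section WaveJet.
Variables (R : realType) (n : nat) (u : spacetime R n -> R).
Hypotheses (u_smooth : smooth u) (u_wave : forall p, box u p = 0).

Lemma jet_t : has_gradient (dt u) (dt (dt u)) (fun i => dx i (dt u)).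
Proof. exact/smooth_has_gradient/smooth_dt. Qed.

Lemma jet_x i : has_gradient (dx i u) (dx i (dt u)) (fun j => dx j (dx i u)).
Proof.
have -> : dx i (dt u) = dt (dx i u) by apply/funext => p; rewrite dt_dx.
exact/smooth_has_gradient/smooth_dx.
Qed.

Lemma jet_wave p : \sum_i dx i (dx i u) p = dt (dt u) p.
Proof. by have /eqP := u_wave p; rewrite /box addrC subr_eq0 => /eqP. Qed.

End WaveJet.

Lemma domain_of_dependence (R : realType) n (u : spacetime R n -> R) (t0 rad : R) :
  smooth u -> (forall p, box u p = 0) -> 0 < rad ->
  (forall x, sqn x < rad ^+ 2 -> u (t0, x) = 0 /\ dt u (t0, x) = 0) ->
  forall t x, `|t - t0| < rad -> sqn x < (rad - `|t - t0|) ^+ 2 ->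
  [/\ u (t, x) = 0, dt u (t, x) = 0 & forall i, dx i u (t, x) = 0].
Proof.
move=> su wu r0 d0 t x tr hx.
(* The sign selects the cone on the side of t; the rescaled point is s = |t - t0| / rad, z = x /
   rad. *)
pose sg : R := if t0 <= t then 1 else -1.
have sg2 : sg ^+ 2 = 1 by rewrite /sg; case: ifP => _; rewrite ?sqrrN expr1n.
have tE : t = t0 + sg * rad * (`|t - t0| / rad).
  rewrite mulrAC mulrA -[sg * _ / _ * _]mulrA mulVf ?gt_eqF // mulr1 /sg.
  case: ifP => h; first by rewrite ger0_norm ?subr_ge0 //; ring.
  by rewrite ltr0_norm ?subr_lt0 ?ltNge ?h //; ring.
have xE : x = 0 + rad *: (rad^-1 *: x).
  by rewrite add0r scalerA mulfV ?scale1r ?gt_eqF.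
have := cone_vanish (smooth_has_gradient su) (jet_t su)
  (jet_x su) (jet_wave wu) (t0 := t0) (rad := rad) (sg := sg) r0 sg2 d0
  (s := `|t - t0| / rad) (z := rad^-1 *: x).
rewrite -xE -tE; apply.
  by rewrite divr_ge0 ?(ltW r0) //= ltr_pdivrMr // mul1r.
rewrite sqnZ exprVn mulrC ltr_pdivrMr ?exprn_gt0 // -exprMn.
by rewrite mulrBl mul1r divfK ?gt_eqF.
Qed.

(** * Vanishing weighted moments and multiplication by polynomials *)

Section Moments.
Variables (R : realType) (n : nat).
Implicit Types (f : 'rV[R]_n -> R) (x y z : 'rV[R]_n).

Definition C1 f (Df : 'I_n -> 'rV[R]_n -> R) : Prop :=
  [/\ continuous f, (forall i, continuous (Df i)) &
  forall i x s, der (fun s => f (x + s *: e_ R i)) s (Df i (x + s *: e_ R i))].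

Variables (r d : R).
Hypothesis r0 : 0 < r.

(** All exponents and an open set of centres are required at once, so that the property survives
    multiplication by a coordinate, which moves the centre and changes the exponent. *)
Definition moments_vanish f : Prop :=
  (exists Df, C1 f Df) /\ forall b y, sqn y < d ^+ 2 ->
    mean (fun z => wt 1 z ^+ b.+2 * f (y + r *: z)) = 0.

Lemma moments_vanishD f g : moments_vanish f -> moments_vanish g ->
  moments_vanish (fun x => f x + g x).
Proof.
move=> [[Df [cf cDf dF]] mf] [[Dg [cg cDg dG]] mg]; split.
  exists (fun i x => Df i x + Dg i x); split; [by cts|by move=> i; cts|].
  by move=> i x s; exact: derD.
move=> b y hy; rewrite -[RHS](addr0 0) -{1}(mf b y hy) -(mg b y hy) -meanD; try by cts.
by congr mean; apply/funext => z; rewrite mulrDr.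
Qed.

Lemma moments_vanishZ c f : moments_vanish f -> moments_vanish (fun x => c * f x).
Proof.
move=> [[Df [cf cDf dF]] mf]; split.
  exists (fun i x => c * Df i x); split; [by cts|by move=> i; cts|].
  by move=> i x s; exact: derZ.
move=> b y hy; rewrite -[RHS](mulr0 c) -(mf b y hy) -meanZ; last by cts.
by congr mean; apply/funext => z; rewrite mulrCA.
Qed.

Lemma moments_vanish_sum (I : finType) (F : I -> 'rV[R]_n -> R) f :
  moments_vanish f -> (forall i, moments_vanish (F i)) ->
  moments_vanish (fun x => \sum_i F i x).
Proof.
move=> mf mF; rewrite /index_enum; elim: (locked_with _ _) => [|i s IH].
  have -> : (fun x => \sum_(i <- [::]) F i x) = (fun x => 0 * f x).
    by apply/funext => x; rewrite big_nil mul0r.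
  exact: moments_vanishZ.
have -> : (fun x => \sum_(j <- i :: s) F j x) = (fun x => F i x + \sum_(j <- s) F j x).
  by apply/funext => x; rewrite big_cons.
exact: moments_vanishD.
Qed.

(* Moving the centre y and integrating by parts turns the vanishing moments of
   f into those of z_i f; the moments of y_i f vanish trivially. *)
Lemma moments_vanish_coord i f : moments_vanish f ->
  moments_vanish (fun x => x 0 i * f x).
Proof.
move=> [[Df [cf cDf dF]] mf]; split.
  exists (fun j x => (i == j)%:R * f x + x 0 i * Df j x); split; [by cts| |].
    by move=> j; cts.
  by move=> j x s; apply: derM => //; exact: der_coord.
move=> b y hy.
have cw := @cts_wt R n 1.
(* Differentiation in the centre, starting from the next exponent: [mf b.+1] has weight power
   [b.+3]. *)
have hD : mean (fun z => wt 1 z ^+ b.+3 * Df i (y + r *: z)) = 0.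
  pose G s z := wt 1 z ^+ b.+3 * f (y + r *: z + s *: e_ R i).
  pose G' s z := wt 1 z ^+ b.+3 * Df i (y + r *: z + s *: e_ R i).
  have dmean : der (fun s => mean (G s)) 0 (mean (G' 0)).
    apply: mean_is_derive; rewrite /G /G'; [by move=> s; cts|by cts|].
    by move=> s z; exact: (derZ _ (dF i _ s)).
  have -> : (fun z => wt 1 z ^+ b.+3 * Df i (y + r *: z)) = G' 0.
    by apply/funext => z; rewrite /G' scale0r addr0.
  apply: (der_near0 dmean).
  have c : continuous (fun s : R => sqn (y + s *: e_ R i)).
    by have := @cts_sqn R n => ?; cts.
  have /cvgr_lt/(_ (d ^+ 2)) := c 0; rewrite scale0r addr0 => /(_ hy).
  apply: filterS => s hs; rewrite -(mf b.+1 _ hs); congr mean; apply/funext => z.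
  by rewrite /G addrAC.
(* Integrating by parts in z brings the weight back to the power [b.+2] and produces the factor
   z_i. *)
have hI : mean (fun z => z 0 i * wt 1 z ^+ b.+2 * f (y + r *: z)) = 0.
  have := @wt_ibp R n 1 b.+1 i (fun z => f (y + r *: z)) (fun z => r * Df i (y + r *: z)).
  move=> /(_ (lexx 1)) H; have {H} : mean (fun z => wt 1 z ^+ b.+3 * (r * Df i (y + r *: z))) = 
     2 * b.+3%:R * mean (fun z => z 0 i * wt 1 z ^+ b.+2 * f (y + r *: z)).
    apply: H; try by cts.
    move=> z s.
    have E a : y + r *: (z + a *: e_ R i) = y + r *: z + (r * a) *: e_ R i.
      by rewrite scalerDr scalerA addrA.
    under eq_fun do rewrite E; rewrite E.
    have h := dF i (y + r *: z) (r * s).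
    apply: der_eq (@der_comp R (fun a => f (y + r *: z + a *: e_ R i))
      (fun a => r * a) s _ _ h (derZ r (der_id s))) _.
    by rewrite mulr1 mulrC.
  have -> : (fun z => wt 1 z ^+ b.+3 * (r * Df i (y + r *: z))) =
     (fun z => r * (wt 1 z ^+ b.+3 * Df i (y + r *: z))).
    by apply/funext => z; rewrite mulrCA.
  rewrite meanZ ?hD ?mulr0; last by cts.
  by move/esym/eqP; rewrite mulf_eq0 mulf_eq0 !pnatr_eq0 /= => /eqP.
have -> : (fun z => wt 1 z ^+ b.+2 * ((y + r *: z) 0 i * f (y + r *: z))) =
  (fun z => y 0 i * (wt 1 z ^+ b.+2 * f (y + r *: z)) +
    r * (z 0 i * wt 1 z ^+ b.+2 * f (y + r *: z))).
  by apply/funext => z; rewrite !mxE; ring.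
rewrite meanD ?meanZ; try by cts.
by rewrite mf // hI !mulr0 addr0.
Qed.

Lemma moments_vanish_quadratic x0 c f : moments_vanish f ->
  moments_vanish (fun x => (1 - sqn (x - x0) / c) * f x).
Proof.
move=> mf.
have -> : (fun x => (1 - sqn (x - x0) / c) * f x) = (fun x => f x +
   - c^-1 * \sum_i (x 0 i * (x 0 i * f x) +
     ((- (2 * x0 0 i)) * (x 0 i * f x) + x0 0 i ^+ 2 * f x))).
  apply/funext => x; rewrite mulrBl mul1r; congr (_ + _).
  transitivity (- c^-1 * (sqn (x - x0) * f x)); first by ring.
  congr (_ * _); rewrite /sqn mulr_suml; apply: eq_bigr => i _; rewrite !mxE; ring.
apply: moments_vanishD => //; apply: moments_vanishZ.
apply: (moments_vanish_sum mf) => i.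
apply: moments_vanishD; first by do 2 apply: moments_vanish_coord.
apply: moments_vanishD; last exact: moments_vanishZ.
by apply: moments_vanishZ; exact: moments_vanish_coord.
Qed.

Lemma moments_vanish_quadratic_exp x0 c f m : moments_vanish f ->
  moments_vanish (fun x => (1 - sqn (x - x0) / c) ^+ m * f x).
Proof.
move=> mf; elim: m => [|m IH].
  by have -> : (fun x => (1 - sqn (x - x0) / c) ^+ 0 * f x) = f
    by apply/funext => x; rewrite expr0 mul1r.
have -> : (fun x => (1 - sqn (x - x0) / c) ^+ m.+1 * f x) =
   (fun x => (1 - sqn (x - x0) / c) * ((1 - sqn (x - x0) / c) ^+ m * f x)).
  by apply/funext => x; rewrite exprS mulrA.
exact: moments_vanish_quadratic.
Qed.
End Moments.

(** * Pointwise sign from polynomial peaks *)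

Section Landau.
Variables (R : realType) (n : nat).
Implicit Types (g : 'rV[R]_n -> R) (z : 'rV[R]_n).

Lemma bernoulli_ge (x : R) m : -1 <= x -> 1 + x *+ m <= (1 + x) ^+ m.
Proof.
move=> hx; elim: m => [|m IH]; first by rewrite mulr0n addr0 expr0.
rewrite exprS; apply: le_trans (ler_wpM2l _ IH); last by lra.
have : 0 <= x * x *+ m by rewrite mulrn_wge0 // -expr2 sqr_ge0.
have -> : x * x *+ m = (1 + x) * (1 + x *+ m) - (1 + x *+ m.+1).
  by rewrite mulrSr -(mulr_natr x) -(mulr_natr (x * x)); ring.
by rewrite subr_ge0.
Qed.

(* Testing against powers of the concave peak q: the positive part of g near
   z0 dominates, as q is larger there than where g is negative. *)
Lemma mean_peak_le0 g z0 c : continuous g -> 0 < c ->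
  (forall z, cube z -> sqn (z - z0) <= c) -> (forall i, -1 < z0 0 i < 1) ->
  (forall m, mean (fun z => (1 - sqn (z - z0) / c) ^+ m * g z) = 0) -> g z0 <= 0.
Proof.
move=> cg c0 hc hz0 hm; rewrite leNgt; apply/negP => gz0.
pose q z := 1 - sqn (z - z0) / c.
have cq : continuous q by have := @cts_sqn R n => ?; rewrite /q; cts.
have q01 z : cube z -> 0 <= q z by move=> /hc h; rewrite subr_ge0 ler_pdivrMr ?mul1r.
pose gp z := Num.max 0 (g z); pose gn z := Num.max 0 (- g z).
have cgp : continuous gp by rewrite /gp; cts.
have cgn : continuous gn by rewrite /gn; cts.
have gE z : g z = gp z - gn z.
  by rewrite /gp /gn; case: (leP 0 (g z)) => h; case: (leP 0 (- g z)) => h'; lra.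
have : \forall z \near z0, 0 < g z by have /cvgr_gt/(_ 0 gz0) := cg z0.
move=> /nbhs_ballP[d /= d0 hd].
(* A point of the cube where g < 0 differs from z0 by at least d in some coordinate, so q is at most
   1 - d^2 / c there; the maximum with 1/2 keeps [th] positive. *)
have [th /andP[th0 th1] hth] : exists2 th : R,
    0 < th < 1 & forall z, cube z -> g z < 0 -> q z <= th.
  exists (Num.max 2^-1 (1 - d ^+ 2 / c)).
    rewrite lt_max invr_gt0 ltr0n /= gt_max invf_lt1 ?ltr0n // ltr1n /=.
    by rewrite ltrBlDr ltrDl divr_gt0 ?exprn_gt0.
  move=> z cz gz; rewrite le_max; apply/orP; right.
  rewrite lerD2l lerN2 ler_pM2r ?invr_gt0 //.
  have [i hi] : exists i, d <= `|(z - z0) 0 i|.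
    apply/not_existsP => hn; have : 0 < g z; last by rewrite ltNge (ltW gz).
    apply: hd; split=> // a i; rewrite ord1 /ball /= distrC ltNge.
    by apply/negP => h; apply: (hn i); rewrite !mxE.
  apply: le_trans (sqn_coord _ i); rewrite -[leRHS]real_normK ?num_real //.
  by rewrite ler_sqr ?nnegrE // ltW.
(* By Bernoulli, (q / th)^m is at least m b everywhere on the cube, while it is at most 1 where g <
   0. Hence m times a fixed positive mean stays below the mean of [gn] for all m, which is
   absurd. *)
pose b z := Num.max 0 (q z / th - 1).
have cb : continuous b by rewrite /b; cts.
have b0 z : 0 <= b z by rewrite le_max lexx.
have gp0 z : 0 <= gp z by rewrite le_max lexx.
have gn0 z : 0 <= gn z by rewrite le_max lexx.
have beta0 : 0 < mean (fun z => b z * gp z).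
  apply: (@mean_gt0 _ _ _ z0) => //; first by cts.
    by move=> z _; rewrite mulr_ge0.
  rewrite mulr_gt0 // lt_max ?gz0 ?orbT // /q subrr.
  have -> : sqn (0 : 'rV[R]_n) = 0.
    by rewrite /sqn big1 // => i _; rewrite mxE expr0n.
  by rewrite mul0r subr0 subr_gt0 ltr_pdivlMr // mul1r th1 orbT.
have key m : m%:R * mean (fun z => b z * gp z) <= mean gn.
  rewrite -meanZ; last by cts.
  have E : mean (fun z => (q z / th) ^+ m * gp z) = mean (fun z => (q z / th) ^+ m * gn z).
    apply/eqP; rewrite -subr_eq0 -meanB; try by cts.
    rewrite -(mulr0 (th^-1 ^+ m)) -(hm m) -meanZ; last first.
      by have := cq; rewrite /q => ?; cts.
    by apply/eqP; congr mean; apply/funext => z; rewrite exprMn gE /q; ring.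
  apply: (@le_trans _ _ (mean (fun z => (q z / th) ^+ m * gp z))).
    apply: mean_le; try by cts.
    move=> z cz; rewrite mulrA ler_wpM2r //.
    have qt : 0 <= q z / th by rewrite divr_ge0 ?q01 // ltW.
    rewrite /b; case: (leP 0 (q z / th - 1)) => h; last by rewrite mulr0 exprn_ge0.
    have := @bernoulli_ge (q z / th - 1) m; rewrite [1 + (_ - 1)]addrC subrK => hb.
    by rewrite mulr_natl; apply: le_trans (hb _); lra.
  rewrite E; apply: mean_le; try by cts.
  move=> z cz; rewrite /gn; case: (leP 0 (- g z)) => h; last by rewrite mulr0.
  have [h'|h'] := ltP (g z) 0; last first.
    by have -> : - g z = 0 by [lra]; rewrite mulr0.
  rewrite ler_piMl // exprn_ile1 // ?divr_ge0 ?q01 ?(ltW th0) //.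
  by rewrite ler_pdivrMr // mul1r hth.
have := truncnS_gt (mean gn / mean (fun z => b z * gp z)).
by rewrite ltr_pdivrMr // ltNge key.
Qed.
End Landau.

(** * The Euler-Poisson-Darboux equation for weighted means *)

Section Darboux.
Variables (R : realType) (n : nat).
Local Notation ST := (spacetime R n).
Variables (u ut utt : ST -> R) (ux uxt : 'I_n -> ST -> R).
Variable uxx : 'I_n -> 'I_n -> ST -> R.
Hypotheses (gu : has_gradient u ut ux) (gt : has_gradient ut utt uxt).
Hypotheses (gx : forall i, has_gradient (ux i) (uxt i) (uxx i)).
Hypothesis wave : forall p, \sum_i uxx i i p = utt p.
Variables (y : 'rV[R]_n) (b : nat).
Local Notation pt t r z := (((t, y + r *: z) : ST)).
Local Notation w := (wt (1 : R)).
Implicit Types (z : 'rV[R]_n) (t r s : R) (i j : 'I_n).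

Let cu : continuous u. Proof. by case: gu. Qed.
Let cut : continuous ut. Proof. by case: gu. Qed.
Let cutt : continuous utt. Proof. by case: gt. Qed.
Let cux i : continuous (ux i). Proof. by case: (gx i). Qed.
Let cuxt i : continuous (uxt i). Proof. by case: (gx i). Qed.
Let cuxx i j : continuous (uxx i j). Proof. by case: (gx i). Qed.

Let W t r i := mean (fun z => w z ^+ b.+2 * (z 0 i * ux i (pt t r z))).
Let S t r i j := mean (fun z => w z ^+ b.+2 * (z 0 i * z 0 j * uxx i j (pt t r z))).
Let L t r i := mean (fun z => w z ^+ b.+2 * uxx i i (pt t r z)).

(* With the weight (1 - |z|^2)^(b+2) the means over balls solve the
   Euler-Poisson-Darboux equation M_tt = M_rr + (darboux_coef / r) M_r. *)
Definition darboux_coef : nat := (n + b.*2 + 5)%N.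

Lemma sqn_wt z : sqn z * w z ^+ b.+1 = w z ^+ b.+1 - w z ^+ b.+2.
Proof.
have [h|h] := leP 1 (sqn z); first by rewrite wt_eq0 // !expr0n /= mulr0 subrr.
have E : w z = 1 - sqn z by rewrite /wt max_r // subr_ge0 ltW.
rewrite [w z ^+ b.+2]exprS -[X in X - _]mul1r -mulrBl; congr (_ * _).
by rewrite E; ring.
Qed.

(** Two integrations by parts, of u_i and of z_i z_j u_i summed over j, linked by |z|^2 = 1 - w
    inside the ball. The coefficient collects n + 1 from differentiating z_i z_j and 2(b+2) from the
    weight. *)
Lemma darboux_coord t r i :
  r * \sum_j S t r i j = r * L t r i - darboux_coef%:R * W t r i.
Proof.
pose V := mean (fun z => z 0 i * w z ^+ b.+1 * ux i (pt t r z)).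
have hL : r * L t r i = 2 * b.+2%:R * V.
  have := @wt_ibp R n 1 b i (fun z => ux i (pt t r z))
    (fun z => r * uxx i i (pt t r z)) (lexx 1).
  move=> H; rewrite /L /V -H; try by cts.
    by rewrite -meanZ; [congr mean; apply/funext => z; rewrite mulrCA|cts].
  by move=> z s; exact: der_space_line (gx i).
pose Q j := mean (fun z => z 0 j * w z ^+ b.+1 * (z 0 i * z 0 j * ux i (pt t r z))).
have hQ j : (i == j)%:R * W t r i + W t r i + r * S t r i j = 2 * b.+2%:R * Q j.
  pose G z := z 0 i * z 0 j * ux i (pt t r z).
  pose G' z := ((i == j)%:R * z 0 j + z 0 i) * ux i (pt t r z) +
    z 0 i * z 0 j * (r * uxx i j (pt t r z)).
  have cG : continuous G by rewrite /G; cts.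
  have cG' : continuous G' by rewrite /G'; cts.
  rewrite -[Q j]/(mean (fun z => z 0 j * w z ^+ b.+1 * G z)).
  rewrite -(wt_ibp (i := j) b (lexx 1) cG cG').
    rewrite /W /S -!meanZ -?meanD; try by cts.
    congr mean; apply/funext => z; rewrite /G'.
    by have [->|_] := eqVneq i j; rewrite ?mul1r ?mul0r ?add0r; ring.
  move=> z s; rewrite /G /G'; apply: der_eq (derM (derM (der_coord z i j s) (der_coord z j j s))
    (der_space_line _ _ _ _ _ _ (gx i))) _.
  by rewrite eqxx mulr1.
have hQs : \sum_j Q j = V - W t r i.
  rewrite /Q -mean_sum; last by cts.
  rewrite /V /W -meanB; try by cts.
  congr mean; apply/funext => z.
  transitivity (sqn z * w z ^+ b.+1 * (z 0 i * ux i (pt t r z))).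
    by rewrite /sqn !mulr_suml; apply: eq_bigr => j _; ring.
  by rewrite sqn_wt; ring.
have hs : \sum_j ((i == j)%:R * W t r i + W t r i + r * S t r i j) =
    W t r i + n%:R * W t r i + r * \sum_j S t r i j.
  rewrite !big_split /= -!mulr_sumr; congr (_ + _); congr (_ + _).
    rewrite (bigD1 i) //= eqxx mul1r big1 ?addr0 // => j /negPf ji.
    by rewrite eq_sym ji mul0r.
  by rewrite sumr_const card_ord mulr_natl.
have : W t r i + n%:R * W t r i + r * \sum_j S t r i j = 2 * b.+2%:R * (V - W t r i).
  by rewrite -hs -hQs mulr_sumr; apply: eq_bigr => j _; exact: hQ.
rewrite hL /darboux_coef => E.
have -> : r * \sum_j S t r i j =
    2 * b.+2%:R * (V - W t r i) - W t r i - n%:R * W t r i by rewrite -E; ring.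
by rewrite !natrD -mul2n natrM -[b.+2]addn2 natrD; ring.
Qed.

Definition radial_mean t r := mean (fun z => w z ^+ b.+2 * u (pt t r z)).
Definition radial_mean_r t r :=
  mean (fun z => w z ^+ b.+2 * \sum_i z 0 i * ux i (pt t r z)).
(* The derivative of radial_mean along the direction (1, sg) of the (t, r) plane. *)
Definition riemann_inv sg t r := mean (fun z => w z ^+ b.+2 *
  (ut (pt t r z) + sg * \sum_i z 0 i * ux i (pt t r z))).

Lemma riemann_inv_diff t r :
  riemann_inv 1 t r - riemann_inv (-1) t r = 2 * radial_mean_r t r.
Proof.
rewrite /riemann_inv /radial_mean_r -meanB -?meanZ; try by cts.
by congr mean; apply/funext => z; ring.
Qed.

Lemma der_char f ft fx sg t r z s : has_gradient f ft fx ->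
  der (fun s => f (pt (t - sg * s) (r + s) z)) s
   (- sg * ft (pt (t - sg * s) (r + s) z) +
     \sum_j z 0 j * fx j (pt (t - sg * s) (r + s) z)).
Proof.
move=> [_ _ _ h].
have h1 : forall s, pt (t - sg * s) (r + s) z = pt t r z + s *: ((- sg, z) : ST).
  move=> s'; apply/pair_equal_spec; split => /=.
    by rewrite -[_ *: (- _)]/(s' * (- sg)); ring.
  by rewrite scalerDl addrA.
exact: (h _ _ _ _ s h1).
Qed.

Lemma der_radial_mean t r s :
  der (fun s => radial_mean t (r + s)) s (radial_mean_r t (r + s)).
Proof.
pose G' s z := w z ^+ b.+2 * \sum_i z 0 i * ux i (pt t (r + s) z).
apply: (@mean_is_derive _ _ _ G' s); rewrite /G'; [by move=> a; cts|by cts|].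
move=> a z; apply: derZ.
(* Speed 0 turns the characteristic into a line of constant t. *)
have h := der_char 0 t r z a gu.
rewrite !mul0r !subr0 oppr0 mul0r add0r in h.
suff -> : (fun x => u (pt t (r + x) z)) = (fun s => u (pt (t - 0 * s) (r + s) z)) by [].
by apply/funext => x; rewrite mul0r subr0.
Qed.

(** Along (-sg, 1) the derivative of M_t + sg M_r is sg (M_rr - M_tt), which the Darboux equation
    reduces to a first-order term. *)
Lemma der_riemann_inv sg t r s : sg ^+ 2 = 1 -> r + s != 0 ->
  der (fun s => riemann_inv sg (t - sg * s) (r + s)) s
    (- sg * darboux_coef%:R / (r + s) * radial_mean_r (t - sg * s) (r + s)).
Proof.
move=> sg2 rs.
pose G' s z := w z ^+ b.+2 * (
   (- sg * utt (pt (t - sg * s) (r + s) z) +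
     \sum_j z 0 j * uxt j (pt (t - sg * s) (r + s) z)) +
   sg * \sum_i z 0 i * (- sg * uxt i (pt (t - sg * s) (r + s) z) +
     \sum_j z 0 j * uxx i j (pt (t - sg * s) (r + s) z))).
have h : der (fun s => riemann_inv sg (t - sg * s) (r + s)) s (mean (G' s)).
  apply: mean_is_derive; rewrite /G'; [by move=> a; cts|by cts|].
  move=> a z; apply: derZ; apply: derD; first exact: der_char gt.
  apply: derZ; apply: der_sum => i; apply: derZ.
  exact: der_char (gx i).
apply: der_eq h _.
set t' := t - sg * s; set r' := r + s in rs *.
have -> : G' s = fun z => sg * ((\sum_i \sum_j w z ^+ b.+2 * (z 0 i * z 0 j * uxx i j (pt t' r' z)))
     - \sum_i w z ^+ b.+2 * uxx i i (pt t' r' z)).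
  apply/funext => z; rewrite /G' -/t' -/r'.
  exact: char_algebra sg2 (wave _).
have -> : radial_mean_r t' r' = \sum_i W t' r' i.
  rewrite /W -mean_sum; last by cts.
  by congr mean; apply/funext => z; rewrite mulr_sumr.
rewrite meanZ ?meanB ?mean_sum; try by cts.
rewrite -mulrA -[RHS]mulrA mulNr -mulrN; congr (_ * _).
rewrite -sumrB mulrA mulr_sumr -sumrN; apply: eq_bigr => i _.
have -> : mean (fun z => \sum_j w z ^+ b.+2 * (z 0 i * z 0 j * uxx i j (pt t' r' z)))
  = \sum_j S t' r' i j by rewrite mean_sum //; cts.
rewrite -/(L t' r' i); apply: (mulfI rs).
rewrite mulrBr darboux_coord mulrN mulrA mulrCA mulfV // mulr1; ring.
Qed.

End Darboux.

(** * Uniqueness along characteristics in the (t, r) plane *)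

Section CharacteristicGronwall.
Variables (R : realType) (P : R -> R -> R -> R) (Q : R -> R -> R).
Variables (k : nat) (eps T M : R).
Hypothesis eps0 : 0 < eps.
Hypothesis P_diff : forall t r, P 1 t r - P (-1) t r = 2 * Q t r.
Hypothesis der_P : forall sg t r s, sg ^+ 2 = 1 -> r + s != 0 ->
  der (fun s => P sg (t - sg * s) (r + s)) s
    (- sg * k.+1%:R / (r + s) * Q (t - sg * s) (r + s)).
Hypothesis P_start : forall sg t, sg ^+ 2 = 1 -> `|t| + eps < T -> P sg t eps = 0.
Hypothesis P_bounded : forall sg t r, sg ^+ 2 = 1 -> eps <= r -> `|t| + r < T ->
  `|P sg t r| <= M.

Let bounded_by W := forall sg t r, sg ^+ 2 = 1 -> eps <= r -> `|t| + r < T ->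
  `|P sg t r| <= W * r ^+ k.+1.

(** The contraction factor: integrating from eps rather than 0 saves eps^(k+1), a fixed proportion
    of r^(k+1) at least (eps / T)^(k+1). *)
Let theta := 1 - (eps / T) ^+ k.+1.

Lemma sign_norm (sg : R) : sg ^+ 2 = 1 -> `|sg| = 1.
Proof.
by move/eqP; rewrite sqrf_eq1 => /orP[] /eqP ->; rewrite ?normrN normr1.
Qed.

(* The weight r ^+ k.+1 is chosen so that the singular coefficient k.+1 / r
   exactly differentiates it along characteristics. *)
Lemma bounded_by_shrink W : bounded_by W -> bounded_by (W * theta).
Proof.
move=> hW sg t r sg2 er tr.
have r0 : 0 < r := lt_le_trans eps0 er.
have W0 : 0 <= W.
  have := le_trans (normr_ge0 _) (hW sg t r sg2 er tr).
  by rewrite pmulr_lge0 // exprn_gt0.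
have T0 : 0 < T by apply: lt_trans r0 (le_lt_trans _ tr); rewrite lerDr.
have rT : r <= T by apply/ltW/(le_lt_trans _ tr); rewrite lerDr.
(* Followed back to r = eps, the characteristic through (t, r) stays in the region |t| + r < T. *)
have dom s : 0 <= s <= r - eps ->
    `|t + sg * (r - eps) - sg * s| + (eps + s) < T.
  move=> /andP[s0 sr]; apply: le_lt_trans tr.
  have -> : t + sg * (r - eps) - sg * s = t + sg * (r - eps - s) by ring.
  have := ler_normD t (sg * (r - eps - s)).
  rewrite normrM (sign_norm sg2) mul1r (@ger0_norm _ (r - eps - s)) ?subr_ge0 //.
  by move: (`|t + _|) => a; lra.
(* The sign [tau] replaces the absolute value, so that a differentiable function can be compared. *)
suff key tau : tau ^+ 2 = 1 -> tau * P sg t r <= W * r ^+ k.+1 - W * eps ^+ k.+1.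
  have h1 : `|P sg t r| <= W * r ^+ k.+1 - W * eps ^+ k.+1.
    rewrite ler_norml lerNl -mulN1r key ?sqrrN ?expr1n //=.
    by rewrite -[leLHS]mul1r key ?expr1n.
  apply: le_trans h1 _; rewrite -mulrA -mulrBr ler_wpM2l // /theta mulrBl mul1r.
  rewrite lerD2l lerN2 -exprMn ler_pXn2r
    ?nnegrE ?mulr_ge0 ?invr_ge0 ?(ltW eps0) ?(ltW T0) ?(ltW r0) //.
  by rewrite mulrAC ler_pdivrMr // ler_pM2l.
move=> tau2.
pose t1 := t + sg * (r - eps).
(* Since |Q| is at most the average of the two |P|, the weight grows at least as fast as tau P, and
   F is monotone from the foot t1, where P = 0. *)
pose F s := W * (eps + s) ^+ k.+1 - tau * P sg (t1 - sg * s) (eps + s).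
pose F' s := W * (k.+1%:R * (eps + s) ^+ k) -
  tau * (- sg * k.+1%:R / (eps + s) * Q (t1 - sg * s) (eps + s)).
have dF s : 0 <= s <= r - eps -> der F s (F' s).
  move=> /andP[s0 sr]; apply: derD.
    by apply: derZ; apply: der_eq (derX k (derD (derC eps s) (der_id s))) _; rewrite add0r mulr1.
  by apply: derN; apply: derZ; apply: der_P => //; rewrite gt_eqF // ltr_pwDl.
have re : 0 <= r - eps by rewrite subr_ge0.
have [c /[dup] hc /andP[c0 cr] E] := MVT_in re dF.
have ec : 0 < eps + c by rewrite ltr_pwDl.
have F'0 : 0 <= F' c.
  have hQ : `|Q (t1 - sg * c) (eps + c)| <= W * (eps + c) ^+ k.+1.
    have h1 := hW 1 (t1 - sg * c) (eps + c) (expr1n _ _).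
    have h2 := hW (-1) (t1 - sg * c) (eps + c).
    rewrite sqrrN expr1n in h2.
    have ec' : eps <= eps + c by rewrite lerDl.
    have {}h1 := h1 ec' (dom c hc); have {}h2 := h2 erefl ec' (dom c hc).
    have := ler_normB (P 1 (t1 - sg * c) (eps + c)) (P (-1) (t1 - sg * c) (eps + c)).
    rewrite P_diff normrM ger0_norm //.
    move: h1 h2; set p1 := `|P 1 _ _|; set p2 := `|P _ _ _|; set q := `|Q _ _|.
    by set w := W * _; lra.
  rewrite /F' subr_ge0; apply: le_trans (ler_norm _) _.
  rewrite !normrM normrN (sign_norm sg2) (sign_norm tau2) !mul1r normfV (gtr0_norm ec) normr_nat.
  apply: (@le_trans _ _ (k.+1%:R / (eps + c) * (W * (eps + c) ^+ k.+1))).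
    by rewrite ler_wpM2l // divr_ge0 // ltW.
  by rewrite exprS le_eqVlt; apply/orP; left; apply/eqP; field; rewrite gt_eqF.
have : F 0 <= F (r - eps) by rewrite -subr_ge0 E subr0 mulr_ge0.
rewrite /F /t1 mulr0 subr0 addr0 [eps + (r - eps)]addrC subrK addrK P_start //.
  by rewrite mulr0 subr0 !lerBrDr addrC.
by have := dom 0; rewrite mulr0 subr0 addr0 lexx re; apply.
Qed.

(** The a priori bound M gives a first constant, and each shrinking multiplies it by theta < 1; a
    geometric sequence replaces the exponential. *)
Lemma char_gronwall sg t r : sg ^+ 2 = 1 -> eps <= r -> `|t| + r < T -> P sg t r = 0.
Proof.
move=> sg2 er tr.
have rT : r < T by apply: le_lt_trans tr; rewrite lerDr.
have T0 : 0 < T := lt_trans (lt_le_trans eps0 er) rT.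
have b0 : bounded_by (M / eps ^+ k.+1).
  move=> sg' t' r' h1 h2 h3; apply: le_trans (P_bounded h1 h2 h3) _.
  have M0 : 0 <= M := le_trans (normr_ge0 _) (P_bounded h1 h2 h3).
  rewrite mulrAC ler_pdivlMr ?exprn_gt0 // ler_wpM2l // ler_pXn2r // nnegrE ltW //.
  exact: lt_le_trans h2.
have bj j : bounded_by (M / eps ^+ k.+1 * theta ^+ j).
  elim: j => [|j IH]; first by rewrite expr0 mulr1.
  by rewrite [theta ^+ _]exprSr mulrA; exact: bounded_by_shrink.
have th : `|theta| < 1.
  have e1 : 0 < eps / T < 1.
    by rewrite divr_gt0 //= ltr_pdivrMr // mul1r (le_lt_trans er).
  have /andP[h1 h2] := e1.
  have h3 : (eps / T) ^+ k.+1 < 1 by rewrite exprn_ilt1 // ltW.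
  have h4 : 0 < (eps / T) ^+ k.+1 by rewrite exprn_gt0.
  by rewrite /theta ger0_norm ?subr_ge0 ?(ltW h3) // ltrBlDr ltrDl.
have cv : (M / eps ^+ k.+1 * r ^+ k.+1) * theta ^+ j @[j --> \oo] -->
    (M / eps ^+ k.+1 * r ^+ k.+1) * 0.
  by apply: cvgMr; exact: cvg_expr.
apply/eqP; rewrite -normr_le0 -(mulr0 (M / eps ^+ k.+1 * r ^+ k.+1)).
apply: (cvgr_to_ge cv); apply: nearW => j.
by rewrite mulrAC; exact: bj.
Qed.

End CharacteristicGronwall.

(** * Propagation of vanishing means to larger radii *)

Section RadialMeans.
Variables (R : realType) (n : nat).
Local Notation ST := (spacetime R n).
Variables (u ut utt : ST -> R) (ux uxt : 'I_n -> ST -> R).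
Variable uxx : 'I_n -> 'I_n -> ST -> R.
Hypotheses (gu : has_gradient u ut ux) (gt : has_gradient ut utt uxt).
Hypotheses (gx : forall i, has_gradient (ux i) (uxt i) (uxx i)).
Hypothesis wave : forall p, \sum_i uxx i i p = utt p.
Let cu : continuous u. Proof. by case: gu. Qed.
Let cut : continuous ut. Proof. by case: gu. Qed.
Let cux i : continuous (ux i). Proof. by case: (gx i). Qed.

Lemma bounded_box3 (f : (R * R) * 'rV[R]_n -> R) (T : R) : continuous f ->
  exists M, forall t r z, `|t| <= T -> `|r| <= T -> cube z -> `|f ((t, r), z)| <= M.
Proof.
move=> cf; have [T0|T0] := ltP T 0.
  by exists 0 => t r z tT; have := le_lt_trans (le_trans (normr_ge0 _) tT) T0; rewrite ltxx.
pose K := (`[- T, T]%classic `*` `[- T, T]%classic) `*` @cube R n.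
have cK : compact K.
  apply: compact_setX (@cube_compact R n).
  by apply: compact_setX; exact: segment_compact.
have K0 : K !=set0.
  exists ((0, 0), 0); split => /=; first by split; rewrite /= in_itv /= oppr_le0 T0.
  by move=> i; rewrite mxE; apply/andP; split; lra.
have ca : continuous (fun q => `|f q|).
  by move=> q; apply: continuous_comp; [exact: cf|exact: norm_continuous].
have [c _ hc] := compact_EVT_max K0 cK (continuous_subspaceT ca).
exists `|f c| => t r z tT rT cz; apply: hc; rewrite inE; split => //=.
by split; rewrite /= in_itv /= -ler_norml.
Qed.

Variables (y : 'rV[R]_n) (b : nat) (eps T : R).
Hypothesis eps0 : 0 < eps.
Hypothesis near_axis : forall t z, `|t| + eps < T -> sqn z < 1 ->
  [/\ u (t, y + eps *: z) = 0, ut (t, y + eps *: z) = 0 &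
      forall i, ux i (t, y + eps *: z) = 0].

Lemma mean_wt_eq0 (f : 'rV[R]_n -> R) : continuous f ->
  (forall z, sqn z < 1 -> f z = 0) -> mean (fun z => wt 1 z ^+ b.+2 * f z) = 0.
Proof.
move=> cf h; apply: mean_eq0; first by cts.
move=> z _; have [h1|h1] := leP 1 (sqn z); last by rewrite h // mulr0.
by rewrite wt_eq0 // expr0n /= mul0r.
Qed.

Lemma riemann_inv_vanish sg t r : sg ^+ 2 = 1 -> eps <= r -> `|t| + r < T ->
  riemann_inv ut ux y b sg t r = 0.
Proof.
pose f sg (q : (R * R) * 'rV[R]_n) := wt 1 q.2 ^+ b.+2 *
  (ut (q.1.1, y + q.1.2 *: q.2) + sg * \sum_i q.2 0 i * ux i (q.1.1, y + q.1.2 *: q.2)).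
have cf sg' : continuous (f sg') by rewrite /f; cts.
have [M1 hM1] := bounded_box3 T (cf 1).
have [M2 hM2] := bounded_box3 T (cf (-1)).
have dc : darboux_coef n b = (n + b.*2 + 4).+1 by rewrite /darboux_coef addnS.
apply: (@char_gronwall R (riemann_inv ut ux y b) (radial_mean_r ux y b)
  (n + b.*2 + 4) eps T (Num.max M1 M2)) => //.
- by move=> t' r'; apply: riemann_inv_diff; eassumption.
- by move=> sg' t' r' s h1 h2; rewrite -dc; by apply: der_riemann_inv; eassumption.
- move=> sg' t' h1 h2; apply: mean_wt_eq0; first by cts.
  move=> z z1; have [_ -> h3] := near_axis h2 z1.
  by rewrite add0r big1 ?mulr0 // => i _; rewrite h3 mulr0.
move=> sg' t' r' /eqP; rewrite sqrf_eq1 => h1 h2 h3.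
have tT : `|t'| <= T.
  by apply/ltW/(le_lt_trans _ h3); rewrite lerDl (le_trans (ltW eps0)).
have rT : `|r'| <= T.
  rewrite ger0_norm; last exact: le_trans (ltW eps0) h2.
  by apply/ltW/(le_lt_trans _ h3); rewrite lerDr.
case/orP: h1 => /eqP ->; (apply: mean_norm_le; first by cts) => z cz; rewrite le_max.
  by rewrite (hM1 t' r' z).
by rewrite (hM2 t' r' z) ?orbT.
Qed.

(** The radial derivative is half the difference of the two invariants, both zero, and the mean
    vanishes at r = eps. *)
Lemma radial_mean_vanish t r : eps <= r -> `|t| + r < T ->
  radial_mean u y b t r = 0.
Proof.
move=> er tr.
have re : 0 <= r - eps by rewrite subr_ge0.
have [c /andP[c0 cr]] := MVT_in re (fun s _ => der_radial_mean gu gx y b t eps s).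
rewrite [eps + (r - eps)]addrC subrK addr0.
have -> : radial_mean u y b t eps = 0.
  apply: mean_wt_eq0; first by cts.
  have te : `|t| + eps < T by apply: le_lt_trans tr; rewrite lerD2l.
  by move=> z z1; have [] := near_axis te z1.
have ec : eps <= eps + c by rewrite lerDl.
have tc : `|t| + (eps + c) < T by apply: le_lt_trans tr; rewrite lerD2l; lra.
have := riemann_inv_diff gu gx y b t (eps + c).
rewrite !riemann_inv_vanish ?sqrrN ?expr1n // subrr => /esym/eqP.
by rewrite mulf_eq0 pnatr_eq0 /= => /eqP ->; rewrite mul0r subr0.
Qed.

End RadialMeans.

(** * From moments to pointwise values *)

Lemma eucl_norm_lt (R : realType) n (x : 'rV[R]_n) (rho : R) : 0 < rho ->
  (eucl_norm x < rho) = (sqn x < rho ^+ 2).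
Proof.
move=> r0; rewrite -[eucl_norm x < _](@ltr_pXn2r _ 2) ?nnegrE ?sqrtr_ge0 ?ltW //.
by rewrite sqr_sqrtr //; exact: sqn_ge0.
Qed.

Lemma moments_vanish_le0 (R : realType) n (f : 'rV[R]_n -> R) (r d : R) z :
  0 < r -> 0 < d -> moments_vanish r d f -> sqn z < 1 -> f (r *: z) <= 0.
Proof.
move=> r0 d0 mf z1.
have [[Df [cf _ _]] _] := mf.
(* Squared distances in the cube are at most 4n, each coordinate contributing at most 2^2; the added
   1 makes [c] positive for every n. *)
pose c : R := 4 * n%:R + 1.
have c0 : 0 < c by rewrite /c ltr_wpDl // mulr_ge0.
pose g x := wt 1 x ^+ 2 * f (0 + r *: x).
have cg : continuous g by rewrite /g; cts.
have hz i : -1 < z 0 i < 1 := sqn_lt1_coord i z1.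
have : g z <= 0.
  apply: (mean_peak_le0 cg c0 _ hz).
    move=> x cx; apply: (@le_trans _ _ (\sum_(i < n) 4)); last first.
      by rewrite sumr_const card_ord -[_ *+ n]mulr_natr /c lerDl.
    apply: ler_sum => i _; rewrite !mxE.
    have /andP[h1 h2] := cx i; have /andP[h3 h4] := hz i.
    have -> : 4 = 2 ^+ 2 :> R by ring.
    by rewrite -[leLHS]real_normK ?num_real // ler_sqr ?nnegrE // ler_norml; lra.
  move=> m.
  (* The peak is centred at r z with scale r^2 c, so that after x -> r x it becomes the peak at z
     with constant c. *)
  have [_ /(_ 0%N 0)] := moments_vanish_quadratic_exp (r *: z) (r ^+ 2 * c) m mf.
  have -> : sqn (0 : 'rV[R]_n) = 0 by rewrite /sqn big1 // => i _; rewrite mxE expr0n.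
  rewrite exprn_gt0 // => /(_ isT) <-; congr mean; apply/funext => x.
  rewrite /g mulrCA; congr (_ * (_ * _)); congr ((1 - _) ^+ _).
  rewrite add0r -scalerBr sqnZ invfM mulrACA mulfV ?mul1r //.
  by rewrite expf_neq0 // gt_eqF.
by rewrite /g add0r pmulr_rle0 // exprn_gt0 // wt_gt0.
Qed.

(** * From the two initial balls to the double cone *)

Section UniqueContinuation.
Variables (R : realType) (n : nat) (u : spacetime R n -> R).
Hypotheses (u_smooth : smooth u) (u_wave : forall p, box u p = 0).
Hypothesis vanish_future : data_vanish_on u (@B R n 1 2).
Hypothesis vanish_past : data_vanish_on u (@B R n (-1) 2).
Implicit Types (t r : R) (x y z : 'rV[R]_n).

(** The cone over the future ball has radius 2 - |t - 1| at time t, which is at least min(1, 3 - t)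
    for t >= 0; the past ball serves t < 0 symmetrically. *)
Lemma vanish_around_axis beta t x : 0 < beta <= 1 -> `|t| + beta < 3 ->
  sqn x < beta ^+ 2 ->
  [/\ u (t, x) = 0, dt u (t, x) = 0 & forall i, dx i u (t, x) = 0].
Proof.
move=> /andP[b0 b1] tb xb.
have data (t0 : R) : data_vanish_on u (@B R n t0 2) ->
    forall x, sqn x < 2 ^+ 2 -> u (t0, x) = 0 /\ dt u (t0, x) = 0.
  by move=> h x' hx; apply: h; split => //=; rewrite eucl_norm_lt.
have finish (t0 : R) : data_vanish_on u (@B R n t0 2) -> beta <= 2 - `|t - t0| ->
    [/\ u (t, x) = 0, dt u (t, x) = 0 & forall i, dx i u (t, x) = 0].
  move=> h bt; apply: (domain_of_dependence u_smooth u_wave (ltr0n R 2) (data _ h)).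
    by rewrite -subr_gt0 (lt_le_trans b0).
  by apply: lt_le_trans xb _; rewrite ler_sqr ?nnegrE ?(ltW b0) // (le_trans (ltW b0)).
have [t0|t0] := leP 0 t.
  apply: (finish 1) => //; rewrite ger0_norm // in tb.
  by have : `|t - 1| <= 2 - beta by [rewrite ler_norml; lra]; lra.
apply: (finish (-1)) => //; rewrite ltr0_norm // in tb.
by have : `|t - -1| <= 2 - beta by [rewrite ler_norml; lra]; lra.
Qed.

Lemma time_slice_moments t r : 0 < r -> `|t| + r < 3 ->
  exists2 d, 0 < d & moments_vanish r d (fun x => u (t, x)).
Proof.
move=> r0 tr.
(* With [eps <= 1/2] below, d <= 1/2 keeps the tube radius d + eps within 1; the other bound leaves
   |t| + r < 3 - d, the bound T for the radial evolution. *)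
pose d := Num.min (2^-1) ((3 - `|t| - r) / 2).
have d0 : 0 < d by rewrite lt_min invr_gt0 ltr0n /= divr_gt0 //; lra.
have d1 : d <= 2^-1 by rewrite ge_min lexx.
have d2 : d <= (3 - `|t| - r) / 2 by rewrite ge_min lexx orbT.
exists d => //; split.
  have [c1 c2 c3 h] := smooth_has_gradient u_smooth.
  exists (fun i x => dx i u (t, x)); split.
  - exact: (cts_comp c1 (cts_spacetime (@cts_cst _ _ t) (@cts_id _))).
  - by move=> i; exact: (cts_comp (c3 i) (cts_spacetime (@cts_cst _ _ t) (@cts_id _))).
  move=> i x s.
  have h1 : forall s, ((t, x + s *: e_ R i) : spacetime R n) =
      (t, x) + s *: ((0, e_ R i) : spacetime R n).
    by move=> s'; apply/pair_equal_spec; split => //=; rewrite scaler0 addr0.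
  apply: der_eq (h _ _ _ _ s h1) _; rewrite mul0r add0r.
  rewrite (bigD1 i) //= !mxE !eqxx mul1r big1 ?addr0 // => j /negPf ji.
  by rewrite !mxE ji mul0r.
move=> b y hy.
pose eps := Num.min r (2^-1 : R).
have e0 : 0 < eps by rewrite lt_min r0 invr_gt0 ltr0n.
have er : eps <= r by rewrite ge_min lexx.
have e1 : eps <= 2^-1 by rewrite ge_min lexx orbT.
apply: (@radial_mean_vanish R n u (dt u) (dt (dt u)) (fun i => dx i u) (fun i => dx i (dt u))
  (fun i j => dx j (dx i u)) (smooth_has_gradient u_smooth) (jet_t u_smooth)
  (jet_x u_smooth) (jet_wave u_wave) y b eps (3 - d) e0) => //; last by lra.
move=> t' z te z1; apply: (@vanish_around_axis (d + eps)); try lra.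
by apply: sqnD_lt => //; exact: ltW.
Qed.

Lemma double_cone_vanish t x : `|t| < 3 -> sqn x < (3 - `|t|) ^+ 2 -> u (t, x) = 0.
Proof.
move=> t3 hx.
have x0 : 0 <= eucl_norm x := sqrtr_ge0 _.
have xt : eucl_norm x < 3 - `|t| by rewrite eucl_norm_lt // subr_gt0.
(* A radius strictly between |x| and 3 - |t|, so that x is interior to the ball of radius r. *)
pose r := (eucl_norm x + (3 - `|t|)) / 2.
have r0 : 0 < r by rewrite /r; lra.
have xr : sqn x < r ^+ 2 by rewrite -eucl_norm_lt // /r; lra.
have [|d d0 mu] := @time_slice_moments t r r0; first by rewrite /r; lra.
have z1 : sqn (r^-1 *: x) < 1.
  by rewrite sqnZ exprVn mulrC ltr_pdivrMr ?exprn_gt0 // mul1r.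
have xE : r *: (r^-1 *: x) = x by rewrite scalerA mulfV ?scale1r ?gt_eqF.
have h1 := moments_vanish_le0 r0 d0 mu z1.
have h2 := moments_vanish_le0 r0 d0 (moments_vanishZ (-1) mu) z1.
rewrite xE in h1 h2; rewrite mulN1r oppr_le0 in h2.
by apply/eqP; rewrite eq_le h1.
Qed.

End UniqueContinuation.

Theorem theorem1p1 (R : realType) (n : nat) (hn : (1 <= n)%N)
    (phi : spacetime R n -> R)
    (phi_smooth : smooth phi)
    (phi_wave : forall p : spacetime R n, box phi p = 0)
    (vanish_future : data_vanish_on phi (@B R n 1 2))
    (vanish_past : data_vanish_on phi (@B R n (-1) 2)) :
  data_vanish_on phi (@B R n 0 3).
Proof.
move=> [_ x] [/= -> hx].
have x0 : 0 <= eucl_norm x := sqrtr_ge0 _.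
(* The double cone contains a time segment around (0, x), so the time derivative vanishes as
   well. *)
have cone t : `|t| < 3 - eucl_norm x -> phi (t, x) = 0.
  move=> ht; apply: double_cone_vanish => //; first by lra.
  by rewrite -eucl_norm_lt; lra.
split; first by apply: cone; rewrite normr0; lra.
have [_ _ _ h] := smooth_has_gradient phi_smooth.
have h1 : forall s : R, ((s, x) : spacetime R n) = (0, x) + s *: ((1, 0) : spacetime R n).
  move=> s; apply/pair_equal_spec; split => /=; last by rewrite scaler0 addr0.
  by rewrite -[_ *: 1]/(s * 1) mulr1 add0r.
have h2 := h _ _ _ _ 0 h1.
have -> : dt phi (0, x) = 1 * dt phi (0, x) + \sum_i (0 : 'rV[R]_n) 0 i * dx i phi (0, x).
  by rewrite mul1r big1 ?addr0 // => i _; rewrite mxE mul0r.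
apply: (der_near0 h2).
have : \forall s \near (0 : R), `|s| < 3 - eucl_norm x.
  by apply: nbhs0_lt; rewrite subr_gt0.
by apply: filterS => s; exact: cone.
Qed.
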